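(* Let $\alpha,\beta,\gamma,\mu,\nu,\kappa,D$ be constants with $\nu\neq0$ and $\gamma\neq0$. Then the equation $$(\nu H+\mu D^{2})H^{(4)}+\alpha H'H'''+\beta (H'')^{2}+(2\gamma H+\kappa-D^{2})H''+2\gamma (H')^{2}=0$$ for $H=H(z)$ is linearizable if and only if $$\alpha=4\nu,\qquad \beta=3\nu,\qquad \kappa=\frac{(2\gamma\mu+\nu)D^2}{\nu}.$$ Under these conditions, the equation is mapped by the point transformation $$\tilde t=\tan\left(\sqrt{\frac{\gamma}{5\nu}}\,z\right),\qquad \tilde u=\sec^3\left(\sqrt{\frac{\gamma}{5\nu}}\,z\right)\left[\frac{H^2}{2}+\frac{D^2\mu}{\nu}H\right]$$ to the linear equation $$\tilde u^{(4)}-9\cos^8\left(\sqrt{\frac{\gamma}{5\nu}}\,z\right)\tilde u=0.$$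
   Context: The equation for $H$ is the equation satisfied by the profile $H$, with $z=x-Dt$ and $D$ a constant phase velocity, of travelling wave solutions $u(x,t)=H(x-Dt)$ of the partial differential equation $u_{tt}=(\kappa u+\gamma u^2)_{xx}+\nu u u_{xxxx}+\mu u_{xxtt}+\alpha u_xu_{xxx}+\beta u_{xx}^2$. A fourth-order ordinary differential equation for $H(z)$ is called linearizable if it can be reduced by a point transformation $\tilde t=\varphi(z,H)$, $\tilde u=\psi(z,H)$ to a linear equation $\tilde u^{(4)}+\tilde\alpha(\tilde t)\tilde u'+\tilde\beta(\tilde t)\tilde u=0$, where $\tilde t$ and $\tilde u$ are the new independent and dependent variables. In the resulting linear equation, $\tilde u^{(4)}$ is the fourth derivative of $\tilde u$ with respect to $\tilde t$, and $z$ is related to $\tilde t$ by $\tilde t=\tan\left(\sqrt{\gamma/(5\nu)}\,z\right)$. *)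

(* Defs.v *)
From HB Require Import structures.
From mathcomp Require Import all_boot all_order all_algebra.
From mathcomp Require Export complex.
From mathcomp Require Import all_classical all_reals all_analysis.

Set Implicit Arguments.
Unset Strict Implicit.
Unset Printing Implicit Defensive.

Import Order.TTheory GRing.Theory Num.Theory.
Import numFieldNormedType.Exports.
Local Open Scope classical_set_scope.
Local Open Scope ring_scope.

(* In ring_scope these notations would denote polynomial derivatives. *)
Local Notation "f ^` ()" := (derive1 f) : ring_scope.
Local Notation "f ^` ( n )" := (derive1n n f) : ring_scope.

(* The scalar field K is meant to be R (derivatives are real) or R[i]
   (derivatives are complex, so that differentiable means holomorphic). *)

Section PointTransformations.
Context {K : numFieldType}.
Implicit Types (U : set (K * K)) (phi psi f : K * K -> K) (H t u w a b : K -> K).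

Fixpoint class_C (n : nat) U f : Prop :=
  if n is m.+1 then
    (forall p, U p -> differentiable f p) /\
    (forall v : K * K, class_C m U ('D_v f))
  else forall p, U p -> {for p, continuous f}.

Definition smooth_on U f : Prop := forall n, class_C n U f.

(* Being a point transformation is a local notion: a nonvanishing Jacobian
   makes (phi, psi) locally invertible, global injectivity is not required. *)
Definition point_transformation U phi psi : Prop :=
  [/\ open U, U !=set0, smooth_on U phi, smooth_on U psi &
   forall p, U p ->
     'D_(1, 0) phi p * 'D_(0, 1) psi p
     - 'D_(0, 1) phi p * 'D_(1, 0) psi p != 0].

(* A fourth-order equation is a condition E H z on a function H at a point z
   (only used for an H satisfying the next condition). *)
Definition four_times_derivable H (z : K) : Prop :=
  \forall x \near z, forall k, (k < 4)%N -> derivable H^`(k) x 1.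

(* d/dt, for functions of z, along a change of parameter t = t(z). *)
Definition deriv_wrt t u : K -> K := fun z => u^`() z / t^`() z.

(* E is mapped by t = phi(z, H), u = psi(z, H) to u'''' + a(t) u' + b(t) u = 0:
   along every curve H in U on which t is a local parameter, E holds at a point
   if and only if the linear equation does at the corresponding point. *)
Definition mapped_to_linear (E : (K -> K) -> K -> Prop) U phi psi a b : Prop :=
  (forall p, U p ->
     {for phi p, continuous a} /\ {for phi p, continuous b}) /\
  (forall H (z : K), U (z, H z) -> four_times_derivable H z ->
     let t := fun x => phi (x, H x) in
     let u := fun x => psi (x, H x) in
     t^`() z != 0 ->
     (E H z <->
      iter 4 (deriv_wrt t) u z + a (t z) * deriv_wrt t u z + b (t z) * u z
      = 0)).

Definition linearizable (E : (K -> K) -> K -> Prop) : Prop :=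
  exists U phi psi a b,
    point_transformation U phi psi /\ mapped_to_linear E U phi psi a b.

Definition profile_eq (alpha beta gamma mu nu kappa D : K) H (z : K) : Prop :=
  (nu * H z + mu * D ^+ 2) * H^`(4) z
  + alpha * H^`(1) z * H^`(3) z
  + beta * (H^`(2) z) ^+ 2
  + (2 * gamma * H z + kappa - D ^+ 2) * H^`(2) z
  + 2 * gamma * (H^`(1) z) ^+ 2 = 0.

(* If u = w o t near z, then deriv_wrt iterates to the derivatives of w:
   this is the u^(n) of the linear equation, as a function of t. *)
Lemma iter_deriv_wrtE (n : nat) t u w (z : K) :
  (\forall x \near z, derivable t x 1 /\ t^`() x != 0) ->
  (\forall y \near t z, forall k, (k < n)%N -> derivable w^`(k) y 1) ->
  (\forall x \near z, u x = w (t x)) ->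
  iter n (deriv_wrt t) u z = w^`(n) (t z).
Proof.
move=> tE fE uE.
suff: \forall x \near z, iter n (deriv_wrt t) u x = w^`(n) (t x).
  by move=> /nbhs_singleton.
have tc : t @ z --> t z.
  have [/derivable1_diffP d _] := nbhs_singleton tE.
  exact: differentiable_continuous.
have {}fE : \forall x \near z, forall k, (k < n)%N ->
    derivable w^`(k) (t x) 1 by exact: (tc _ fE).
elim: n fE => [//|n IH] fE.
have {}IH : \forall x \near z, iter n (deriv_wrt t) u x = w^`(n) (t x).
  apply: IH; apply: filterS fE => x /= h k kn; apply: h; exact: ltnW.
have {}IH := near_join IH.
near=> x.
have IHx : \forall y \near x, iter n (deriv_wrt t) u y = w^`(n) (t y).
  by near: x.
have [dt t0] : derivable t x 1 /\ t^`() x != 0 by near: x.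
have df : derivable w^`(n) (t x) 1.
  have h : forall k, (k < n.+1)%N -> derivable w^`(k) (t x) 1 by near: x.
  exact: h.
rewrite iterS derive1nS /deriv_wrt.
have -> : (iter n (deriv_wrt t) u)^`() x = t^`() x * w^`(n)^`() (t x).
  have -> : (iter n (deriv_wrt t) u)^`() x = (w^`(n) \o t)^`() x.
    by rewrite !derive1E; exact: near_eq_derive.
  move: dt df => /derivable1_diffP dt /derivable1_diffP df.
  rewrite derive1E'; last exact: differentiable_comp.
  rewrite diff_comp// !derive1E'//= -[X in 'd _ _ X = _]mulr1.
  by rewrite [LHS]linearZ.
by rewrite [X in X / _]mulrC mulfK.
Unshelve. all: by end_near. Qed.

End PointTransformations.

Section ComplexTrigonometry.
Context {R : realType}.
Implicit Types z : R[i].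

Definition expC z : R[i] :=
  Complex (expR (complex.Re z) * cos (complex.Im z))
          (expR (complex.Re z) * sin (complex.Im z)).

Definition cosC z : R[i] :=
  (expC (Complex 0 1 * z) + expC (- (Complex 0 1 * z))) / 2.

Definition sinC z : R[i] :=
  (expC (Complex 0 1 * z) - expC (- (Complex 0 1 * z))) / (2 * Complex 0 1).

Definition tanC z : R[i] := sinC z / cosC z.

End ComplexTrigonometry.

(* Main.v *)
Require Import Defs.
From mathcomp Require Import all_boot all_order all_algebra.
From mathcomp Require Import all_classical all_reals all_analysis.
From mathcomp Require Import ring lra.

Set Implicit Arguments.
Unset Strict Implicit.
Unset Printing Implicit Defensive.

Import Order.TTheory GRing.Theory Num.Theory.
Import numFieldNormedType.Exports.
Local Open Scope classical_set_scope.
Local Open Scope ring_scope.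

(* Necessity: evaluate the equivalence along polynomial curves with an arbitrary
   4-jet (y1, y2, y3, y4) at a point.  Both sides are affine in y4 with the same root,
   hence proportional, and the coefficients of monomials in y1, y2, y3 can be compared.
   - y2 y3: phi_y = 0, so t depends on z only;
   - y1 y3, y2^2, y1^2 y2: with A = nu y + mu D^2, 4 A psi_yy = alpha psi_y,
     3 A psi_yy = beta psi_y and psi_yyy = 0; differentiating the first relation
     gives psi_yy (alpha - 4 nu) = 0;
   - in both cases psi_yy / psi_y depends on y only, so psi = V(y) k(z) + l(z), and the
     coefficients of y2 and y1^2 give (psi_yy / psi_y) (2 gamma y + kappa - D^2) = 2 gamma.
     This excludes psi_yy = 0 and yields the condition on kappa.
   Comparing coefficients needs no symmetry of mixed partial derivatives, only that a
   function with zero derivative on a ball is constant.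

   Sufficiency: with v = H^2/2 + (D^2 mu / nu) H the equation is nu v^(4) + 2 gamma v^(2) = 0.
   If c^(2) = - q c with q = gamma / (5 nu), then t' = m / c^2 and u = c^-3 v turn
   v^(4) + 10 q v^(2) + 9 q^2 v into a multiple of the fourth derivative of u.  The choice
   c = cos gives the stated transformation; when q < 0 over the reals, c is an exponential. *)

(** * Derivative rules at a point *)

Section Calculus.
Context {K : numFieldType}.
Implicit Types (f g h : K -> K) (x z a b : K).

(* Not a type class, unlike [is_derive], so that applying the rules below does not
   trigger instance resolution. *)
Definition deriv_at x f a : Prop := is_derive x 1 f a.

Lemma deriv_at_eq x f a b : deriv_at x f a -> a = b -> deriv_at x f b.
Proof. by move=> ? <-. Qed.

Lemma deriv_atD f g x a b : deriv_at x f a -> deriv_at x g b ->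
  deriv_at x (fun y => f y + g y) (a + b).
Proof. move=> ? ?; exact: is_deriveD. Qed.

Lemma deriv_atN f x a : deriv_at x f a ->
  deriv_at x (fun y => - f y) (- a).
Proof. by move=> ?; exact: is_deriveN. Qed.

Lemma deriv_atM f g x a b : deriv_at x f a -> deriv_at x g b ->
  deriv_at x (fun y => f y * g y) (f x * b + g x * a).
Proof. by move=> ? ?; exact: is_deriveM. Qed.

Lemma deriv_atX f n x a : deriv_at x f a ->
  deriv_at x (fun y => f y ^+ n) (n%:R * f x ^+ n.-1 * a).
Proof.
elim: n => [|n IH] df.
  by rewrite mul0r mul0r; under eq_fun do rewrite expr0; exact: is_derive_cst.
have := deriv_atM df (IH df); under eq_fun do rewrite -exprS.
move/deriv_at_eq; apply; case: n {IH} => [|n]; first by rewrite expr0 !mul0r; ring.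
by rewrite /= exprS; ring.
Qed.

Lemma deriv_atV f x a : f x != 0 -> deriv_at x f a ->
  deriv_at x (fun y => (f y)^-1) (- (f x) ^- 2 * a).
Proof.
by move=> f0 [df <-]; apply: DeriveDef; [exact: derivableV|rewrite deriveV].
Qed.

Lemma deriv_at_comp f g x a b : deriv_at (g x) f a ->
  deriv_at x g b -> deriv_at x (fun y => f (g y)) (a * b).
Proof.
move=> [/derivable1_diffP df <-] [/derivable1_diffP dg <-].
have dfg : differentiable (f \o g) x by exact: differentiable_comp.
apply: DeriveDef; first exact/derivable1_diffP.
rewrite -[LHS]derive1E derive1E' // diff_comp //= -[X in 'd f _ X]mulr1.
by rewrite [LHS]linearZ /= -!derive1E' // !derive1E [LHS]mulrC.
Qed.

Lemma deriv_at_id x : deriv_at x (fun y : K => y) 1.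
Proof. exact: is_derive_id. Qed.

Lemma deriv_at_cst x a : deriv_at x (fun=> a) 0.
Proof. exact: is_derive_cst. Qed.

Lemma deriv_at_continuous f x a : deriv_at x f a -> {for x, continuous f}.
Proof.
by move=> [/derivable1_diffP df _]; exact: differentiable_continuous.
Qed.

Lemma near_neq0 f z : {for z, continuous f} -> f z != 0 ->
  \forall x \near z, f x != 0.
Proof.
by move=> fc f0; apply: (@cvgr_neq0 K K K (nbhs z) _ f (f z)).
Qed.

End Calculus.

(** Meant for goals whose derivative is still an existential variable, as left by [deriv_at_eq]: the
    rules build the derivative, and an algebraic identity remains. *)
Ltac derive := repeat first
  [ eassumption
  | apply: deriv_at_cst | apply: deriv_at_id
  | apply: deriv_atD | apply: deriv_atN | apply: deriv_atM
  | apply: deriv_atX ].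

(** * Iterated derivatives with respect to a new parameter *)

Section Quotients.
Context {K : numFieldType} (t t1 t2 t3 t4 u u1 u2 u3 u4 : K -> K) (x : K).
Hypotheses (t0 : t1 x != 0)
  (dt1 : deriv_at x t1 (t2 x)) (dt2 : deriv_at x t2 (t3 x))
  (dt3 : deriv_at x t3 (t4 x))
  (du1 : deriv_at x u1 (u2 x)) (du2 : deriv_at x u2 (u3 x))
  (du3 : deriv_at x u3 (u4 x)).

(** One power of [t1] is cancelled in the quotient rule, so the denominators of the successive
    [deriv_wrt] are [t1] to the powers 1, 3, 5 and 7. *)
Let deriv_at_div_expr (f : K -> K) n (a b : K) :
  deriv_at x f a -> a * t1 x - n.+1%:R * f x * t2 x = b ->
  deriv_at x (fun y => f y / t1 y ^+ n.+1) (b / t1 x ^+ n.+2).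
Proof.
move=> df <-; apply: deriv_at_eq.
  apply: deriv_atM df _; apply: deriv_atV; first by rewrite expf_neq0.
  exact: deriv_atX dt1.
rewrite /= !exprS; move: (t1 x) t0 (t2 x) (f x) => y y0 y2 fx.
by field; rewrite expf_neq0.
Qed.

Lemma deriv_at_deriv_wrt1 : deriv_at x (fun y => u1 y / t1 y)
  ((u2 x * t1 x - u1 x * t2 x) / t1 x ^+ 2).
Proof.
under eq_fun do rewrite -[t1 _]expr1.
by apply: (deriv_at_div_expr du1); ring.
Qed.

Lemma deriv_at_deriv_wrt2 :
  deriv_at x (fun y => (u2 y * t1 y - u1 y * t2 y) / t1 y ^+ 2 / t1 y)
  ((u3 x * t1 x ^+ 2 - 3 * u2 x * t1 x * t2 x - u1 x * t1 x * t3 x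
    + 3 * u1 x * t2 x ^+ 2) / t1 x ^+ 4).
Proof.
under eq_fun do rewrite -mulrA -invfM -exprSr.
by apply: deriv_at_div_expr; [derive|ring].
Qed.

Lemma deriv_at_deriv_wrt3 :
  deriv_at x (fun y => (u3 y * t1 y ^+ 2 - 3 * u2 y * t1 y * t2 y
    - u1 y * t1 y * t3 y + 3 * u1 y * t2 y ^+ 2) / t1 y ^+ 4 / t1 y)
  ((u4 x * t1 x ^+ 3 - 6 * u3 x * t1 x ^+ 2 * t2 x - 4 * u2 x * t1 x ^+ 2 * t3 x
   + 15 * u2 x * t1 x * t2 x ^+ 2 - u1 x * t1 x ^+ 2 * t4 x
   + 10 * u1 x * t1 x * t2 x * t3 x - 15 * u1 x * t2 x ^+ 3) / t1 x ^+ 6).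
Proof.
under eq_fun do rewrite -mulrA -invfM -exprSr.
by apply: deriv_at_div_expr; [derive|rewrite /=; ring].
Qed.

End Quotients.

Section Jets.
Context {K : numFieldType}.
Implicit Types (t u : K -> K) (z : K).

(** The derivatives are explicit functions rather than [derive1n], so that formulas for sums,
    products and compositions can be carried along near [z]. *)
Definition jet4 (f f1 f2 f3 f4 : K -> K) (z : K) : Prop :=
  \forall x \near z, [/\ deriv_at x f (f1 x), deriv_at x f1 (f2 x),
                        deriv_at x f2 (f3 x) & deriv_at x f3 (f4 x)].

(** An equality near [z] also holds near each point close to [z], so it can be differentiated and
    the result again holds near [z], ready for the next iteration. *)
Lemma near_deriv_wrt t t1 f g g1 z :
  (\forall x \near z, deriv_at x t (t1 x)) ->
  (\forall x \near z, f x = g x) ->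
  (\forall x \near z, deriv_at x g (g1 x)) ->
  \forall x \near z, deriv_wrt t f x = g1 x / t1 x.
Proof.
move=> dt /near_join fg dg; near=> x.
have fgx : \forall y \near x, f y = g y by near: x.
have [_ dtx] : deriv_at x t (t1 x) by near: x.
have [_ dgx] : deriv_at x g (g1 x) by near: x.
by rewrite /deriv_wrt !derive1E dtx (near_eq_derive _ fgx) dgx.
Unshelve. all: by end_near. Qed.

(** The chain-rule expression of the fourth derivative of u in t, when [ti] and [ui] are the i-th
    derivatives of t and u in a common parameter. *)
Definition deriv4_wrt (t1 t2 t3 t4 u1 u2 u3 u4 : K) : K :=
  (u4 * t1 ^+ 3 - 6 * u3 * t1 ^+ 2 * t2 - 4 * u2 * t1 ^+ 2 * t3
   + 15 * u2 * t1 * t2 ^+ 2 - u1 * t1 ^+ 2 * t4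
   + 10 * u1 * t1 * t2 * t3 - 15 * u1 * t2 ^+ 3) / t1 ^+ 7.

Lemma iter4_deriv_wrt t t1 t2 t3 t4 u u1 u2 u3 u4 z :
  jet4 t t1 t2 t3 t4 z -> jet4 u u1 u2 u3 u4 z -> t1 z != 0 ->
  iter 4 (deriv_wrt t) u z =
  deriv4_wrt (t1 z) (t2 z) (t3 z) (t4 z) (u1 z) (u2 z) (u3 z) (u4 z).
Proof.
move=> jt ju t10.
have {}t10 : \forall x \near z, t1 x != 0.
  apply: near_neq0 => //; have [_ d _ _] := nbhs_singleton jt.
  exact: deriv_at_continuous d.
have dt : \forall x \near z, deriv_at x t (t1 x).
  by apply: filterS jt => x [].
have E1 : \forall x \near z, iter 1 (deriv_wrt t) u x = u1 x / t1 x.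
  apply: (near_deriv_wrt dt (g := u)); first by near=> x.
  by apply: filterS ju => x [].
have E2 : \forall x \near z, iter 2 (deriv_wrt t) u x =
    ((u2 x * t1 x - u1 x * t2 x) / t1 x ^+ 2) / t1 x.
  apply: (near_deriv_wrt dt E1).
  by apply: filterS3 t10 jt ju => x ? [? ? ? ?] [? ? ? ?]; exact: deriv_at_deriv_wrt1.
have E3 : \forall x \near z, iter 3 (deriv_wrt t) u x =
    ((u3 x * t1 x ^+ 2 - 3 * u2 x * t1 x * t2 x - u1 x * t1 x * t3 x
      + 3 * u1 x * t2 x ^+ 2) / t1 x ^+ 4) / t1 x.
  apply: (near_deriv_wrt dt E2).
  by apply: filterS3 t10 jt ju => x ? [? ? ? ?] [? ? ? ?]; exact: deriv_at_deriv_wrt2.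
have E4 : \forall x \near z, iter 4 (deriv_wrt t) u x =
    ((u4 x * t1 x ^+ 3 - 6 * u3 x * t1 x ^+ 2 * t2 x - 4 * u2 x * t1 x ^+ 2 * t3 x
   + 15 * u2 x * t1 x * t2 x ^+ 2 - u1 x * t1 x ^+ 2 * t4 x
   + 10 * u1 x * t1 x * t2 x * t3 x - 15 * u1 x * t2 x ^+ 3) / t1 x ^+ 6) / t1 x.
  apply: (near_deriv_wrt dt E3).
  by apply: filterS3 t10 jt ju => x ? [? ? ? ?] [? ? ? ?]; exact: deriv_at_deriv_wrt3.
by rewrite (nbhs_singleton E4) /deriv4_wrt -mulrA -invfM -exprSr.
Unshelve. all: by end_near. Qed.

End Jets.

(** * Derivatives of a function of two variables along the graph of a curve *)

Section Curves.
Context {K : numFieldType}.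
Implicit Types (U : set (K * K)) (F G : K * K -> K) (H : K -> K) (p : K * K).
Implicit Types (x y z : K).

Local Notation Dx F := ('D_(1, 0) F).
Local Notation Dy F := ('D_(0, 1) F).

Lemma smooth_on_derive U F v : smooth_on U F -> smooth_on U ('D_v F).
Proof. by move=> sF n; have [_ /(_ v)] := sF n.+1. Qed.

Lemma smooth_on_differentiable U F p : smooth_on U F -> U p -> differentiable F p.
Proof. by move=> sF; have [dF _] := sF 1%N; exact: dF. Qed.

Lemma deriv_at_curve F (g h : K -> K) x a b :
  differentiable F (g x, h x) -> deriv_at x g a -> deriv_at x h b ->
  deriv_at x (fun y => F (g y, h y)) (a * Dx F (g x, h x) + b * Dy F (g x, h x)).
Proof.
move=> dF [/derivable1_diffP dg <-] [/derivable1_diffP dh <-].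
have dgh : differentiable (fun y => (g y, h y)) x by exact: differentiable_pair.
have dFgh : differentiable (F \o (fun y => (g y, h y))) x.
  exact: differentiable_comp.
apply: DeriveDef; first exact/derivable1_diffP.
rewrite -[LHS]derive1E derive1E' // diff_comp //= diff_pair //=.
rewrite (deriveE _ dg) (deriveE _ dh) !(deriveE _ dF).
set g1 := 'd g x 1; set h1 := 'd h x 1.
have -> : (g1, h1) = g1 *: (1, 0) + h1 *: (0, 1) :> K * K.
  by congr pair; rewrite /= /GRing.scale /= ?mulr1 ?mulr0 ?addr0 ?add0r.
by rewrite linearD !linearZ.
Qed.

Lemma deriv_at_graph F H x b : differentiable F (x, H x) -> deriv_at x H b ->
  deriv_at x (fun y => F (y, H y)) (Dx F (x, H x) + b * Dy F (x, H x)).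
Proof.
move=> dF dH; apply: deriv_at_eq.
  exact: (deriv_at_curve dF (deriv_at_id x) dH).
by rewrite mul1r.
Qed.

Lemma deriv_at_vertical F x y : differentiable F (x, y) ->
  deriv_at y (fun y' => F (x, y')) (Dy F (x, y)).
Proof.
move=> dF; apply: deriv_at_eq.
  exact: (deriv_at_curve dF (deriv_at_cst _ _) (deriv_at_id _)).
by rewrite mul0r add0r mul1r.
Qed.

Definition total_jet4 H H1 H2 H3 H4 : Prop :=
  forall x, [/\ deriv_at x H (H1 x), deriv_at x H1 (H2 x),
               deriv_at x H2 (H3 x) & deriv_at x H3 (H4 x)].

(** These quartic Taylor polynomials are the test curves of the necessity proof. *)
Lemma exists_total_jet4 (z y0 y1 y2 y3 y4 : K) :
  exists H H1 H2 H3 H4, total_jet4 H H1 H2 H3 H4 /\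
    [/\ H z = y0, H1 z = y1, H2 z = y2, H3 z = y3 & H4 z = y4].
Proof.
exists (fun x => y0 + y1 * (x - z) + y2 / 2 * (x - z) ^+ 2 + y3 / 6 * (x - z) ^+ 3
         + y4 / 24 * (x - z) ^+ 4),
  (fun x => y1 + y2 * (x - z) + y3 / 2 * (x - z) ^+ 2 + y4 / 6 * (x - z) ^+ 3),
  (fun x => y2 + y3 * (x - z) + y4 / 2 * (x - z) ^+ 2),
  (fun x => y3 + y4 * (x - z)), (fun=> y4).
split; last by split; rewrite ?subrr ?expr0n /= ?mulr0 ?addr0.
move=> x; split; (apply: deriv_at_eq; first by derive); rewrite /=; move: (x - z) => d.
all: by field.
Qed.

Lemma total_jet4_derive1n H H1 H2 H3 H4 z : total_jet4 H H1 H2 H3 H4 ->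
  four_times_derivable H z /\
  [/\ derive1n 1 H z = H1 z, derive1n 2 H z = H2 z,
      derive1n 3 H z = H3 z & derive1n 4 H z = H4 z].
Proof.
move=> jH.
have E1 : derive1n 1 H = H1.
  by apply/funext => x; rewrite derive1n1 derive1E; have [[_]] := jH x.
have E2 : derive1n 2 H = H2.
  by apply/funext => x; rewrite derive1nS E1 derive1E; have [_ [_]] := jH x.
have E3 : derive1n 3 H = H3.
  by apply/funext => x; rewrite derive1nS E2 derive1E; have [_ _ [_]] := jH x.
have E4 : derive1n 4 H = H4.
  by apply/funext => x; rewrite derive1nS E3 derive1E; have [_ _ _ [_]] := jH x.
split; last by rewrite E1 E2 E3 E4.
rewrite /four_times_derivable; near=> x; have [[d0 _] [d1 _] [d2 _] [d3 _]] := jH x.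
case=> [|[|[|[|k]]]] k4; [exact: d0|rewrite E1; exact: d1|rewrite E2; exact: d2| |].
  by rewrite E3; exact: d3.
by discriminate k4.
Unshelve. all: by end_near. Qed.

Lemma near_graph U H z b : open U -> U (z, H z) -> deriv_at z H b ->
  \forall x \near z, U (x, H x).
Proof.
move=> oU Up [/derivable1_diffP dH _].
have dc : differentiable (fun x => (x, H x)) z by exact: differentiable_pair.
by apply: (differentiable_continuous dc); exact: open_nbhs_nbhs.
Qed.

(** The partial derivatives are abstracted to operators [x_] and [y_] that preserve a class [S] and
    obey the chain rule along graphs. Four uses of that rule give the formulas, with words in [x_]
    and [y_] as atoms for [ring]. *)
Let curve_jet4_gen U (x_ y_ : (K * K -> K) -> K * K -> K) (S : (K * K -> K) -> Prop) F p :
  (forall G, S G -> S (x_ G)) -> (forall G, S G -> S (y_ G)) ->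
  (forall G H b x, S G -> U (x, H x) -> deriv_at x H b ->
    deriv_at x (fun y => G (y, H y)) (x_ G (x, H x) + b * y_ G (x, H x))) ->
  open U -> S F -> U p ->
  exists (e0 e1 m s r0 r1 : K) (c3 c4 : K -> K),
  forall H H1 H2 H3 H4, total_jet4 H H1 H2 H3 H4 -> H p.1 = p.2 ->
  let y1 := H1 p.1 in let y2 := H2 p.1 in let y3 := H3 p.1 in
  let y4 := H4 p.1 in
  exists f1 f2 f3 f4, jet4 (fun x => F (x, H x)) f1 f2 f3 f4 p.1 /\
    [/\ f1 p.1 = x_ F p + y_ F p * y1,
        f2 p.1 = y_ F p * y2 + y_ (y_ F) p * y1 ^+ 2 + e1 * y1 + e0,
        f3 p.1 = y_ F p * y3 + (3 * y_ (y_ F) p * y1 + m) * y2 + c3 y1 &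
        f4 p.1 = y_ F p * y4 + (4 * y_ (y_ F) p * y1 + s) * y3
          + 3 * y_ (y_ F) p * y2 ^+ 2
          + (6 * y_ (y_ (y_ F)) p * y1 ^+ 2 + r1 * y1 + r0) * y2 + c4 y1].
Proof.
move=> sx sy SD.
case: p => z y0 oU sF Up /=.
(* [P1] and [P2] collect the third derivatives with one and two occurrences of [y_]; [M] is the part
   free of [H1] in the coefficient of [H2] in the third derivative. [P1d], [P2d] and [Md] apply one
   more operator [d] termwise. *)
pose P1 p := y_ (x_ (x_ F)) p + x_ (y_ (x_ F)) p + x_ (x_ (y_ F)) p.
pose P2 p := y_ (y_ (x_ F)) p + y_ (x_ (y_ F)) p + x_ (y_ (y_ F)) p.
pose M p := y_ (x_ F) p + x_ (y_ F) p + x_ (y_ F) p.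
pose P1d (d : (K * K -> K) -> K * K -> K) p :=
  d (y_ (x_ (x_ F))) p + d (x_ (y_ (x_ F))) p + d (x_ (x_ (y_ F))) p.
pose P2d (d : (K * K -> K) -> K * K -> K) p :=
  d (y_ (y_ (x_ F))) p + d (y_ (x_ (y_ F))) p + d (x_ (y_ (y_ F))) p.
pose Md (d : (K * K -> K) -> K * K -> K) p :=
  d (y_ (x_ F)) p + d (x_ (y_ F)) p + d (x_ (y_ F)) p.
pose q := (z, y0).
exists (x_ (x_ F) q), (y_ (x_ F) q + x_ (y_ F) q), (M q), (M q + x_ (y_ F) q),
  (P1 q + Md x_ q), (2 * P2 q + Md y_ q + 3 * x_ (y_ (y_ F)) q),
  (fun h => x_ (x_ (x_ F)) q + P1 q * h + P2 q * h ^+ 2 + y_ (y_ (y_ F)) q * h ^+ 3),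
  (fun h => x_ (x_ (x_ (x_ F))) q + y_ (x_ (x_ (x_ F))) q * h
     + (P1d x_ q * h + P1d y_ q * h ^+ 2) + (P2d x_ q * h ^+ 2 + P2d y_ q * h ^+ 3)
     + x_ (y_ (y_ (y_ F))) q * h ^+ 3 + y_ (y_ (y_ (y_ F))) q * h ^+ 4).
move=> H h1 h2 h3 h4 jH Hz.
pose c x := (x, H x).
exists (fun x => x_ F (c x) + y_ F (c x) * h1 x).
exists (fun x => x_ (x_ F) (c x) + (y_ (x_ F) (c x) + x_ (y_ F) (c x)) * h1 x
         + y_ (y_ F) (c x) * h1 x ^+ 2 + y_ F (c x) * h2 x).
exists (fun x => x_ (x_ (x_ F)) (c x)
   + (y_ (x_ (x_ F)) (c x) + x_ (y_ (x_ F)) (c x) + x_ (x_ (y_ F)) (c x)) * h1 x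
   + (y_ (y_ (x_ F)) (c x) + y_ (x_ (y_ F)) (c x) + x_ (y_ (y_ F)) (c x)) * h1 x ^+ 2
   + y_ (y_ (y_ F)) (c x) * h1 x ^+ 3
   + (y_ (x_ F) (c x) + x_ (y_ F) (c x) + x_ (y_ F) (c x) + 3 * y_ (y_ F) (c x) * h1 x)
       * h2 x
   + y_ F (c x) * h3 x).
exists (fun x => x_ (x_ (x_ (x_ F))) (c x) + y_ (x_ (x_ (x_ F))) (c x) * h1 x
     + (P1d x_ (c x) * h1 x + P1d y_ (c x) * h1 x ^+ 2)
     + (P2d x_ (c x) * h1 x ^+ 2 + P2d y_ (c x) * h1 x ^+ 3)
     + x_ (y_ (y_ (y_ F))) (c x) * h1 x ^+ 3 + y_ (y_ (y_ (y_ F))) (c x) * h1 x ^+ 4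
     + (P1 (c x) + Md x_ (c x) + (2 * P2 (c x) + Md y_ (c x)
         + 3 * x_ (y_ (y_ F)) (c x)) * h1 x + 6 * y_ (y_ (y_ F)) (c x) * h1 x ^+ 2) * h2 x
     + 3 * y_ (y_ F) (c x) * h2 x ^+ 2
     + (M (c x) + x_ (y_ F) (c x) + 4 * y_ (y_ F) (c x) * h1 x) * h3 x
     + y_ F (c x) * h4 x).
split; last first.
  have -> : c z = q by rewrite /c Hz.
  by split; rewrite -/q /P1d /P2d /Md /P1 /P2 /M; [|ring..].
have : \forall x \near z, U (c x).
  by have [dH _ _ _] := jH z; apply: near_graph dH; rewrite ?Hz.
apply: filterS => x Ux; have [dH dh1 dh2 dh3] := jH x.
have D G : S G -> deriv_at x (fun y => G (c y)) (x_ G (c x) + h1 x * y_ G (c x)).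
  by move=> sG; exact: SD.
rewrite /P1d /P2d /Md /P1 /P2 /M.
split; (apply: deriv_at_eq;
  first by derive; (apply: D; auto));
  rewrite /=; ring.
Qed.

(* The mixed partial derivatives of F are not assumed to commute, so the
   coefficients that are not needed explicitly are existentially quantified;
   they must not depend on the curve. *)
Lemma curve_jet4 U F p : open U -> smooth_on U F -> U p ->
  exists (e0 e1 m s r0 r1 : K) (c3 c4 : K -> K),
  forall H H1 H2 H3 H4, total_jet4 H H1 H2 H3 H4 -> H p.1 = p.2 ->
  let y1 := H1 p.1 in let y2 := H2 p.1 in let y3 := H3 p.1 in
  let y4 := H4 p.1 in
  exists f1 f2 f3 f4, jet4 (fun x => F (x, H x)) f1 f2 f3 f4 p.1 /\
    [/\ f1 p.1 = Dx F p + Dy F p * y1,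
        f2 p.1 = Dy F p * y2 + Dy (Dy F) p * y1 ^+ 2 + e1 * y1 + e0,
        f3 p.1 = Dy F p * y3 + (3 * Dy (Dy F) p * y1 + m) * y2 + c3 y1 &
        f4 p.1 = Dy F p * y4 + (4 * Dy (Dy F) p * y1 + s) * y3
          + 3 * Dy (Dy F) p * y2 ^+ 2
          + (6 * Dy (Dy (Dy F)) p * y1 ^+ 2 + r1 * y1 + r0) * y2 + c4 y1].
Proof.
move=> oU sF Up.
apply: (@curve_jet4_gen U (fun G => Dx G) (fun G => Dy G) (smooth_on U)) => //.
- by move=> G; exact: smooth_on_derive.
- by move=> G; exact: smooth_on_derive.
- move=> G H b x sG Ux; apply: deriv_at_graph; exact: smooth_on_differentiable sG Ux.
Qed.

End Curves.

(** * Comparison of coefficients in the jet variables *)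

(** Here y is the fourth derivative of the curve. With f and g the y-derivatives of [phi] and [psi],
    the factor [t1 * g - u1 * f] is the Jacobian. *)
Lemma deriv4_wrt_affine (K : numFieldType) (t1 t2 t3 t4 u1 u2 u3 u4 f g y : K) :
  t1 != 0 ->
  deriv4_wrt t1 t2 t3 (f * y + t4) u1 u2 u3 (g * y + u4) =
  (t1 * g - u1 * f) / t1 ^+ 5 * y + deriv4_wrt t1 t2 t3 t4 u1 u2 u3 u4.
Proof. by move=> t10; rewrite /deriv4_wrt; field. Qed.

Lemma deriv4_wrt_affine0 (K : numFieldType) (t1 t2 t3 t4 u1 u2 u3 u4 g y : K) :
  t1 != 0 ->
  deriv4_wrt t1 t2 t3 t4 u1 u2 u3 (g * y + u4) =
  g / t1 ^+ 4 * y + deriv4_wrt t1 t2 t3 t4 u1 u2 u3 u4.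
Proof. by move=> t10; rewrite /deriv4_wrt; field. Qed.

(** Here y and z stand for the second and third derivatives of the curve. The mixed difference
    cancels all terms in y alone or z alone and leaves the coefficient of y z. *)
Lemma deriv4_wrt_mixed_difference (K : numFieldType)
    (t1 u1 f f2 f3 f30 f43 f42 f41 f40 g g2 g3 g30 g43 g42 g41 g40 : K) :
  t1 != 0 ->
  let t2 y := f * y + f2 in let u2 y := g * y + g2 in
  let t3 y z := f * z + f3 * y + f30 in let u3 y z := g * z + g3 * y + g30 in
  let t4 y z := f43 * z + f42 * y ^+ 2 + f41 * y + f40 in
  let u4 y z := g43 * z + g42 * y ^+ 2 + g41 * y + g40 in
  let N y z := deriv4_wrt t1 (t2 y) (t3 y z) (t4 y z) u1 (u2 y) (u3 y z) (u4 y z) in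
  N 1 1 - N 1 0 - N 0 1 + N 0 0 = - 10 * f * (t1 * g - u1 * f) / t1 ^+ 6.
Proof. by move=> t10 /=; rewrite /deriv4_wrt; field. Qed.

(** Finite differences at 0, 1 and -1 extract the coefficients of y1 y3, y2^2 and y1^2 y2, and
    cancel the unknown functions [c3] and [c4] of y1. *)
Lemma deriv4_wrt_fibered_coefs (K : numFieldType)
    (t1 t2 t3 t4 g h k s0 e0 e1 m s r0 r1 a b A alpha beta q gamma : K)
    (c3 c4 : K -> K) : t1 != 0 -> A != 0 ->
  (forall y1 y2 y3,
    (alpha * y1 * y3 + beta * y2 ^+ 2 + q * y2 + 2 * gamma * y1 ^+ 2) * (g / t1 ^+ 4)
    = A * (deriv4_wrt t1 t2 t3 t4 (s0 + g * y1) (g * y2 + h * y1 ^+ 2 + e1 * y1 + e0)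
             (g * y3 + (3 * h * y1 + m) * y2 + c3 y1)
             ((4 * h * y1 + s) * y3 + 3 * h * y2 ^+ 2
              + (6 * k * y1 ^+ 2 + r1 * y1 + r0) * y2 + c4 y1)
           + a * ((s0 + g * y1) / t1) + b)) ->
  [/\ alpha * g = 4 * A * h, beta * g = 3 * A * h & k = 0].
Proof.
move=> t10 A0; move=> LE.
pose L y1 y2 y3 := (alpha * y1 * y3 + beta * y2 ^+ 2 + q * y2 + 2 * gamma * y1 ^+ 2)
  * (g / t1 ^+ 4).
have E1 : alpha * g = t1 ^+ 4 * (L 1 0 1 - L 1 0 0 - L 0 0 1 + L 0 0 0).
  by rewrite /L; field.
have E2 : beta * g = t1 ^+ 4 * (L 0 1 0 + L 0 (- 1) 0 - 2 * L 0 0 0) / 2.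
  by rewrite /L; field.
have E3 : t1 ^+ 4 * (L 1 1 0 - L 1 0 0 + (L (- 1) 1 0 - L (- 1) 0 0)
    - 2 * (L 0 1 0 - L 0 0 0)) = 0 by rewrite /L; field.
split; first by rewrite E1 /L !LE /deriv4_wrt; field.
  by rewrite E2 /L !LE /deriv4_wrt; field.
(* The second difference in y1 doubles the coefficient 6 k of y1^2 y2, hence the 12; the left-hand
   side has no such monomial. *)
apply: (mulfI A0); apply: (@mulfI _ 12); first by rewrite pnatr_eq0.
by rewrite !mulr0 -E3 /L !LE /deriv4_wrt; field.
Qed.

(** The arguments are the derivatives of V(H) k + l at a point where V = 0, V' = 1, V'' = w and V'''
    = 0, with y3 = 0 and the y4 term split off. Apart from y1 y2 and y2^2, the variables y2 and y1^2
    enter through y2 + w y1^2 only, so the coefficient of y1^2 is w times that of y2. *)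
Lemma deriv4_wrt_quadratic_coefs (K : numFieldType)
    (t1 t2 t3 t4 w k k1 k2 k3 l1 l2 l3 l4 a b A beta q gamma : K) :
  t1 != 0 -> k != 0 ->
  (forall y1 y2,
    (beta * y2 ^+ 2 + q * y2 + 2 * gamma * y1 ^+ 2) * (k / t1 ^+ 4)
    = A * (deriv4_wrt t1 t2 t3 t4 (y1 * k + l1)
             ((y2 + w * y1 ^+ 2) * k + 2 * y1 * k1 + l2)
             (3 * w * y1 * y2 * k + 3 * (y2 + w * y1 ^+ 2) * k1 + 3 * y1 * k2 + l3)
             (3 * w * y2 ^+ 2 * k + 4 * (3 * w * y1 * y2) * k1
              + 6 * (y2 + w * y1 ^+ 2) * k2 + 4 * y1 * k3 + l4)
           + a * ((y1 * k + l1) / t1) + b)) ->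
  w * q = 2 * gamma.
Proof.
move=> t10 k0; move=> LE.
pose L y1 y2 := (beta * y2 ^+ 2 + q * y2 + 2 * gamma * y1 ^+ 2) * (k / t1 ^+ 4).
have E1 : w * q = w * (t1 ^+ 4 / k) * (L 0 1 - L 0 (- 1)) / 2.
  by rewrite /L; field; rewrite ?k0 ?t10.
have E2 : 2 * gamma = t1 ^+ 4 / k * (L 1 0 + L (- 1) 0 - 2 * L 0 0) / 2.
  by rewrite /L; field; rewrite ?k0 ?t10.
by rewrite E1 E2 /L !LE /deriv4_wrt; field; rewrite ?k0 ?t10.
Qed.

Lemma jet4_near_eq (K : numFieldType) (f g f1 f2 f3 f4 : K -> K) z :
  (\forall x \near z, f x = g x) -> jet4 f f1 f2 f3 f4 z -> jet4 g f1 f2 f3 f4 z.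
Proof.
move=> /near_join fg; apply: filterS2 fg => x fgx [df ? ? ?]; split => //.
exact: near_eq_is_derive fgx df.
Qed.

Lemma jet4D (K : numFieldType) (f f1 f2 f3 f4 g g1 g2 g3 g4 : K -> K) z :
  jet4 f f1 f2 f3 f4 z -> jet4 g g1 g2 g3 g4 z ->
  jet4 (fun x => f x + g x) (fun x => f1 x + g1 x) (fun x => f2 x + g2 x)
    (fun x => f3 x + g3 x) (fun x => f4 x + g4 x) z.
Proof. by apply: filterS2 => x [? ? ? ?] [? ? ? ?]; split; exact: deriv_atD. Qed.

Lemma jet4M (K : numFieldType) (f f1 f2 f3 f4 g g1 g2 g3 g4 : K -> K) z :
  jet4 f f1 f2 f3 f4 z -> jet4 g g1 g2 g3 g4 z ->
  jet4 (fun x => f x * g x) (fun x => f1 x * g x + f x * g1 x)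
    (fun x => f2 x * g x + 2 * f1 x * g1 x + f x * g2 x)
    (fun x => f3 x * g x + 3 * f2 x * g1 x + 3 * f1 x * g2 x + f x * g3 x)
    (fun x => f4 x * g x + 4 * f3 x * g1 x + 6 * f2 x * g2 x + 4 * f1 x * g3 x
              + f x * g4 x) z.
Proof.
apply: filterS2 => x [? ? ? ?] [? ? ? ?].
by split; (apply: deriv_at_eq; first by derive); rewrite /=; ring.
Qed.

(** Serves for the factor V(H) of [psi] in the necessity part and for v in the sufficiency part. *)
Lemma jet4_quadratic (K : numFieldType) (c w0 w1 : K) H H1 H2 H3 H4 z :
  jet4 H H1 H2 H3 H4 z ->
  jet4 (fun x => w1 / 2 * H x ^+ 2 + w0 * H x + c)
    (fun x => (w1 * H x + w0) * H1 x)
    (fun x => (w1 * H x + w0) * H2 x + w1 * H1 x ^+ 2)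
    (fun x => (w1 * H x + w0) * H3 x + 3 * w1 * H1 x * H2 x)
    (fun x => (w1 * H x + w0) * H4 x + 4 * w1 * H1 x * H3 x + 3 * w1 * H2 x ^+ 2) z.
Proof.
apply: filterS => x [? ? ? ?].
by split; (apply: deriv_at_eq; first by derive); rewrite /=; field.
Qed.

(** Isolated as a property of the field because it fails over the rationals, where a function may
    jump at an irrational point. *)
Definition zero_deriv_constant (K : numFieldType) : Prop := forall (f : K -> K) (c r : K),
  (forall y, ball c r y -> deriv_at y f 0) -> forall y, ball c r y -> f y = f c.

Lemma total_jet4_jet4 (K : numFieldType) (H H1 H2 H3 H4 : K -> K) z :
  total_jet4 H H1 H2 H3 H4 -> jet4 H H1 H2 H3 H4 z.
Proof. by move=> jH; rewrite /jet4; near=> x; exact: jH.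
Unshelve. all: by end_near. Qed.

(** * Necessity of the conditions *)

Section Necessity.
Context {K : numFieldType}.
Variables (alpha beta gamma mu nu kappa D : K).
Hypotheses (nu0 : nu != 0) (gamma0 : gamma != 0).
Variables (U : set (K * K)) (phi psi : K * K -> K) (a b : K -> K).
Hypothesis pt : point_transformation U phi psi.
Hypothesis mp :
  mapped_to_linear (profile_eq alpha beta gamma mu nu kappa D) U phi psi a b.

Local Notation Dx F := ('D_(1, 0) F).
Local Notation Dy F := ('D_(0, 1) F).
Local Notation lead p := (nu * p.2 + mu * D ^+ 2).
Local Notation jac p := (Dx phi p * Dy psi p - Dy phi p * Dx psi p).

Let rest (p : K * K) (y1 y2 y3 : K) : K :=
  alpha * y1 * y3 + beta * y2 ^+ 2 + (2 * gamma * p.2 + kappa - D ^+ 2) * y2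
  + 2 * gamma * y1 ^+ 2.

(** The root -N/B determines M in terms of A, and A = 0 would make every y a root of the first
    function. *)
Let affine_same_root (A B M N : K) : B != 0 ->
  (forall y, A * y + M = 0 <-> B * y + N = 0) -> A != 0 /\ M * B = A * N.
Proof.
move=> B0 AB.
have e : A * (- N / B) + M = 0 by apply/AB; field.
split.
  apply/eqP => A0; rewrite A0 mul0r add0r in e.
  have /AB : A * (- N / B + 1) + M = 0 by rewrite A0 e mul0r addr0.
  by apply/eqP; rewrite (_ : _ + N = B) //; field.
have -> : M = A * N / B by rewrite -[LHS]subr0 -[X in _ - X]e; field.
by field.
Qed.

Let jets_equiv H H1 H2 H3 H4 t1 t2 t3 t4 u1 u2 u3 u4 p :
  U p -> total_jet4 H H1 H2 H3 H4 -> H p.1 = p.2 ->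
  jet4 (fun x => phi (x, H x)) t1 t2 t3 t4 p.1 ->
  jet4 (fun x => psi (x, H x)) u1 u2 u3 u4 p.1 ->
  t1 p.1 != 0 ->
  let y1 := H1 p.1 in let y2 := H2 p.1 in let y3 := H3 p.1 in let y4 := H4 p.1 in
  lead p * y4 + rest p y1 y2 y3 = 0 <->
  deriv4_wrt (t1 p.1) (t2 p.1) (t3 p.1) (t4 p.1) (u1 p.1) (u2 p.1) (u3 p.1) (u4 p.1)
  + a (phi p) * (u1 p.1 / t1 p.1) + b (phi p) * psi p = 0.
Proof.
case: p => z y0 /= Up jH Hz jt ju t0 /=.
have [H4d [E1 E2 E3 E4]] := total_jet4_derive1n z jH.
have dt : derive1 (fun x => phi (x, H x)) z = t1 z.
  by rewrite derive1E; have [[_]] := nbhs_singleton jt.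
have du : derive1 (fun x => psi (x, H x)) z = u1 z.
  by rewrite derive1E; have [[_]] := nbhs_singleton ju.
move: (mp.2 H z); cbv zeta; rewrite Hz => /(_ Up H4d).
rewrite dt => /(_ t0); rewrite /profile_eq E1 E2 E3 E4 Hz.
rewrite (iter4_deriv_wrt jt ju t0) /deriv_wrt dt du => <-.
by rewrite /rest !addrA.
Qed.

(** For fixed y1 the transformed side has y2 y3 with coefficient proportional to [Dy phi p] times
    the Jacobian, while the profile equation has no such monomial. *)
Let lead_neq0_Dy_phi p : U p -> lead p != 0 /\ Dy phi p = 0.
Proof.
move=> Up; have [oU _ sphi spsi J0] := pt; have {}J0 := J0 p Up.
(* A slope along which t is a local parameter: 0 if [Dx phi p] is nonzero, and otherwise 1, since
   the Jacobian then forces [Dy phi p] to be nonzero. *)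
have [y1 T0] : exists y1, Dx phi p + Dy phi p * y1 != 0.
  have [e|] := eqVneq (Dx phi p) 0; last by exists 0; rewrite mulr0 addr0.
  exists 1; rewrite e add0r mulr1; apply: contraNneq J0 => ->.
  by rewrite e !mul0r subrr.
set T := Dx phi p + Dy phi p * y1 in T0.
have [e0 [e1 [m [s [r0 [r1 [c3 [c4 jphi]]]]]]]] := curve_jet4 oU sphi Up.
have [e0' [e1' [m' [s' [r0' [r1' [c3' [c4' jpsi]]]]]]]] := curve_jet4 oU spsi Up.
pose S := Dx psi p + Dy psi p * y1.
pose t2 y2 := Dy phi p * y2 + (Dy (Dy phi) p * y1 ^+ 2 + e1 * y1 + e0).
pose u2 y2 := Dy psi p * y2 + (Dy (Dy psi) p * y1 ^+ 2 + e1' * y1 + e0').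
pose t3 y2 y3 := Dy phi p * y3 + (3 * Dy (Dy phi) p * y1 + m) * y2 + c3 y1.
pose u3 y2 y3 := Dy psi p * y3 + (3 * Dy (Dy psi) p * y1 + m') * y2 + c3' y1.
pose t4 y2 y3 := (4 * Dy (Dy phi) p * y1 + s) * y3
          + 3 * Dy (Dy phi) p * y2 ^+ 2
          + (6 * Dy (Dy (Dy phi)) p * y1 ^+ 2 + r1 * y1 + r0) * y2 + c4 y1.
pose u4 y2 y3 := (4 * Dy (Dy psi) p * y1 + s') * y3
          + 3 * Dy (Dy psi) p * y2 ^+ 2
          + (6 * Dy (Dy (Dy psi)) p * y1 ^+ 2 + r1' * y1 + r0') * y2 + c4' y1.
pose N y2 y3 := deriv4_wrt T (t2 y2) (t3 y2 y3) (t4 y2 y3) S (u2 y2) (u3 y2 y3)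
    (u4 y2 y3).
pose N0 := a (phi p) * (S / T) + b (phi p) * psi p.
have JE : T * Dy psi p - S * Dy phi p = jac p.
  by rewrite /T /S; move: (Dx phi p) (Dy phi p) (Dx psi p) (Dy psi p) => *; ring.
(* The existential keeps [Q] opaque. *)
have [Q QE] : exists Q, Q = (T * Dy psi p - S * Dy phi p) / T ^+ 5 by eexists.
have Q0 : Q != 0.
  by rewrite QE JE mulf_neq0 ?invr_neq0 ?expf_neq0.
have key y2 y3 : lead p != 0 /\ rest p y1 y2 y3 * Q = lead p * (N y2 y3 + N0).
  apply: affine_same_root => // y4.
  have [H [H1 [H2 [H3 [H4 [jH [h0 h1 h2 h3 h4]]]]]]] :=
    exists_total_jet4 p.1 p.2 y1 y2 y3 y4.
  have [f1 [f2 [f3 [f4 [jf [E1 E2 E3 E4]]]]]] := jphi _ _ _ _ _ jH h0.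
  have [g1 [g2 [g3 [g4 [jg [F1 F2 F3 F4]]]]]] := jpsi _ _ _ _ _ jH h0.
  rewrite h1 h2 h3 h4 in E1 E2 E3 E4 F1 F2 F3 F4.
  have := jets_equiv Up jH h0 jf jg; rewrite E1 => /(_ T0); cbv zeta.
  rewrite h1 h2 h3 h4 E2 E3 E4 F1 F2 F3 F4 => ->.
  rewrite QE addrA -deriv4_wrt_affine // /N /t2 /u2 /t3 /u3 /t4 /u4 /N0.
  by rewrite !addrA.
split; first by have [] := key 0 0.
have [A0 k00] := key 0 0; have [_ k01] := key 0 1; have [_ k10] := key 1 0.
have [_ k11] := key 1 1.
have : N 1 1 - N 1 0 - N 0 1 + N 0 0 = 0.
  (* The constant [N0] drops out of the mixed difference, which can then be read off from [key]. *)
  have split4 (l c n11 n10 n01 n00 : K) : l * (n11 - n10 - n01 + n00) =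
      l * (n11 + c) - l * (n10 + c) - l * (n01 + c) + l * (n00 + c) by ring.
  apply: (mulfI A0); rewrite mulr0 (split4 _ N0) -k00 -k01 -k10 -k11 /rest.
  set c := 2 * gamma * p.2 + kappa - D ^+ 2; by move: c (2 * gamma) => *; ring.
rewrite (deriv4_wrt_mixed_difference _ _ _ _ _ _ _ _ _ _ _ _ _ _ _ _ _ T0) JE.
move/eqP; rewrite !mulf_eq0 invr_eq0 expf_eq0 (negPf T0) (negPf J0) /= !orbF.
by rewrite oppr_eq0 pnatr_eq0 /= => /eqP.
Qed.

Hypothesis zero_deriv_cst : zero_deriv_constant K.

Let box p : U p -> exists2 r : K, 0 < r &
  forall x y, ball p.1 r x -> ball p.2 r y -> U (x, y).
Proof.
move=> Up; have [oU _ _ _ _] := pt.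
have /nbhs_ballP [r /= r0 rU] : nbhs p U by exact: open_nbhs_nbhs.
by exists r => // x y xr yr; exact: rU.
Qed.

Let total_jet4_cst (c : K) : total_jet4 (fun=> c) (fun=> 0) (fun=> 0) (fun=> 0) (fun=> 0).
Proof. by move=> x; split; exact: deriv_at_cst. Qed.

Let near_ball_graph (r : K) H H1 H2 H3 H4 p : 0 < r ->
  total_jet4 H H1 H2 H3 H4 -> H p.1 = p.2 ->
  \forall x \near p.1, ball p.1 r x /\ ball p.2 r (H x).
Proof.
move=> r0 jH Hp; apply: filterI; first exact: nbhsx_ballx.
have [/deriv_at_continuous cH _ _ _] := jH p.1.
by apply: cH; rewrite Hp; exact: nbhsx_ballx.
Qed.

(** Since [phi] does not vary in y on a box around p, its jet along any curve through p is the one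
    along the constant curve. *)
Let fibered p : U p -> exists t1 t2 t3 t4 : K -> K,
  t1 p.1 != 0 /\ forall H H1 H2 H3 H4, total_jet4 H H1 H2 H3 H4 -> H p.1 = p.2 ->
    jet4 (fun x => phi (x, H x)) t1 t2 t3 t4 p.1.
Proof.
move=> Up; have [oU _ sphi _ /(_ p Up) J0] := pt.
have [e0 [e1 [m [s [r0 [r1 [c3 [c4 jphi]]]]]]]] := curve_jet4 oU sphi Up.
have [t1 [t2 [t3 [t4 [jt [E1 _ _ _]]]]]] := jphi _ _ _ _ _ (total_jet4_cst p.2) erefl.
exists t1, t2, t3, t4; split.
  rewrite E1 mulr0 addr0; apply: contraNneq J0 => ->.
  by have [_ ->] := lead_neq0_Dy_phi Up; rewrite !mul0r subrr.
move=> H H1 H2 H3 H4 jH Hp; apply: jet4_near_eq jt.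
have [r r_gt0 rU] := box Up; apply: filterS (near_ball_graph r_gt0 jH Hp) => x [xr Hr].
apply/esym; apply: (zero_deriv_cst (f := fun y => phi (x, y)) (r := r)) => // y yr.
have Uxy := rU _ _ xr yr; have [_ <-] := lead_neq0_Dy_phi Uxy.
by apply: deriv_at_vertical; exact: smooth_on_differentiable sphi Uxy.
Qed.

(** The jet of t is now the same for all curves, so only that of [psi] varies in the comparison. The
    Jacobian reduces to [Dx phi p * Dy psi p], whence the last claim. *)
Let second_order p : U p ->
  [/\ alpha * Dy psi p = 4 * lead p * Dy (Dy psi) p,
      beta * Dy psi p = 3 * lead p * Dy (Dy psi) p,
      Dy (Dy (Dy psi)) p = 0 & Dy psi p != 0].
Proof.
move=> Up; have [oU _ _ spsi /(_ p Up) J0] := pt; have [A0 phiy] := lead_neq0_Dy_phi Up.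
have [t1 [t2 [t3 [t4 [t10 jphi]]]]] := fibered Up.
have [e0 [e1 [m [s [r0 [r1 [c3 [c4 jpsi]]]]]]]] := curve_jet4 oU spsi Up.
have psiy : Dy psi p != 0.
  by apply: contraNneq J0 => ->; rewrite phiy mulr0 mul0r subrr.
have [] // := @deriv4_wrt_fibered_coefs K (t1 p.1) (t2 p.1) (t3 p.1) (t4 p.1)
  (Dy psi p) (Dy (Dy psi) p) (Dy (Dy (Dy psi)) p) (Dx psi p) e0 e1 m s r0 r1
  (a (phi p)) (b (phi p) * psi p) (lead p) alpha beta (2 * gamma * p.2 + kappa - D ^+ 2)
  gamma c3 c4 t10 A0.
move=> y1 y2 y3; rewrite -/(rest p y1 y2 y3).
have B0 : Dy psi p / t1 p.1 ^+ 4 != 0 by rewrite mulf_neq0 ?invr_neq0 ?expf_neq0.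
apply: (proj2 (affine_same_root B0 _)) => y4.
have [H [H1 [H2 [H3 [H4 [jH [h0 h1 h2 h3 h4]]]]]]] :=
  exists_total_jet4 p.1 p.2 y1 y2 y3 y4.
have [g1 [g2 [g3 [g4 [jg [F1 F2 F3 F4]]]]]] := jpsi _ _ _ _ _ jH h0.
rewrite h1 h2 h3 h4 in F1 F2 F3 F4.
have := jets_equiv Up jH h0 (jphi _ _ _ _ _ jH h0) jg t10; cbv zeta.
rewrite h1 h2 h3 h4 F1 F2 F3 F4 => ->.
by rewrite !addrA -deriv4_wrt_affine0 // !addrA.
Qed.

(** The hypothesis makes [Dy psi] divided by [w1 * y + w0] constant in y; a second integration gives
    the quadratic factor, normalised to have value 0 and derivative 1 at [p.2]. *)
Let separated (w0 w1 : K) : (forall p, U p -> w1 * p.2 + w0 != 0 /\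
    Dy (Dy psi) p * (w1 * p.2 + w0) = w1 * Dy psi p) ->
  forall p, U p -> exists2 r : K, 0 < r & forall x y, ball p.1 r x -> ball p.2 r y ->
    psi (x, y) = (w1 / (w1 * p.2 + w0) / 2 * y ^+ 2 + w0 / (w1 * p.2 + w0) * y
      - (w1 / 2 * p.2 ^+ 2 + w0 * p.2) / (w1 * p.2 + w0)) * Dy psi (x, p.2)
      + psi (x, p.2).
Proof.
move=> w p Up; have [_ _ _ spsi _] := pt; have [r r0 rU] := box Up.
have [wp0 _] := w p Up.
exists r => // x y xr yr.
have dpsi y' : ball p.2 r y' -> deriv_at y' (fun y => psi (x, y)) (Dy psi (x, y')).
  move=> y'r; apply: deriv_at_vertical; apply: smooth_on_differentiable spsi _.
  exact: rU.
have dpsiy y' : ball p.2 r y' ->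
    deriv_at y' (fun y => Dy psi (x, y)) (Dy (Dy psi) (x, y')).
  move=> y'r; apply: deriv_at_vertical.
  apply: smooth_on_differentiable (smooth_on_derive _ spsi) _; exact: rU.
have psiyE y' : ball p.2 r y' -> Dy psi (x, y') =
    (w1 * y' + w0) / (w1 * p.2 + w0) * Dy psi (x, p.2).
  move=> y'r; have [/= w'0 _] := w _ (rU _ _ xr y'r).
  suff q : Dy psi (x, y') / (w1 * y' + w0) = Dy psi (x, p.2) / (w1 * p.2 + w0).
    by rewrite -[LHS](divfK w'0) q mulrC mulrA mulrAC.
  apply: (zero_deriv_cst (f := fun y => Dy psi (x, y) / (w1 * y + w0)) _ y'r).
  move=> y'' y''r; have [/= w''0 e] := w _ (rU _ _ xr y''r).
  apply: deriv_at_eq.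
    apply: deriv_atM (dpsiy _ y''r) _.
    by apply: (deriv_atV (f := fun y => w1 * y + w0) w''0); derive.
  rewrite /=; have -> : Dy (Dy psi) (x, y'') =
      w1 * Dy psi (x, y'') / (w1 * y'' + w0) by rewrite -e mulfK.
  move: (Dy psi (x, y'')) (w1 * y'' + w0) w''0 => d v v0.
  by field.
pose g y := psi (x, y) + - ((w1 / (w1 * p.2 + w0) / 2 * y ^+ 2
  + w0 / (w1 * p.2 + w0) * y) * Dy psi (x, p.2)).
have gE : g y = g p.2.
  apply: (zero_deriv_cst _ yr) => y' y'r.
  apply: deriv_at_eq.
    by rewrite /g; derive; exact: dpsi.
  rewrite /= psiyE //; move: (Dy psi (x, p.2)) (w1 * p.2 + w0) wp0 => d v v0.
  by field.
have -> : psi (x, y) = g y + (w1 / (w1 * p.2 + w0) / 2 * y ^+ 2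
  + w0 / (w1 * p.2 + w0) * y) * Dy psi (x, p.2) by rewrite /g addrNK.
rewrite gE /g; move: (Dy psi (x, p.2)) (psi _) (w1 * p.2 + w0) wp0 => d c v v0.
by field.
Qed.

Let third_order (w0 w1 : K) : (forall p, U p -> w1 * p.2 + w0 != 0 /\
    Dy (Dy psi) p * (w1 * p.2 + w0) = w1 * Dy psi p) ->
  forall p, U p -> w1 / (w1 * p.2 + w0) * (2 * gamma * p.2 + kappa - D ^+ 2)
    = 2 * gamma.
Proof.
move=> w p Up; have [oU _ _ spsi _] := pt.
have [wp0 _] := w p Up; have [_ _ _ k0] := second_order Up.
have [t1 [t2 [t3 [t4 [t10 jphi]]]]] := fibered Up.
have [r r_gt0 psiE] := separated w Up.
(* The jets of l(x) = psi(x, p.2) and k(x) = Dy psi(x, p.2) are those of [psi] and [Dy psi] along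
   the constant curve. *)
have [? [? [? [? [? [? [? [? jl]]]]]]]] := curve_jet4 oU spsi Up.
have [l1 [l2 [l3 [l4 [{}jl _]]]]] := jl _ _ _ _ _ (total_jet4_cst p.2) erefl.
have [? [? [? [? [? [? [? [? jk]]]]]]]] := curve_jet4 oU (smooth_on_derive (0, 1) spsi) Up.
have [k1 [k2 [k3 [k4 [{}jk _]]]]] := jk _ _ _ _ _ (total_jet4_cst p.2) erefl.
set om := w1 / _ in psiE *; set c := - (_ / _) in psiE.
have om0 : om * p.2 + w0 / (w1 * p.2 + w0) = 1.
  by rewrite /om; move: wp0 => ?; field.
have V0 : om / 2 * p.2 ^+ 2 + w0 / (w1 * p.2 + w0) * p.2 + c = 0.
  by rewrite /om /c; move: wp0 => ?; field.
apply: (@deriv4_wrt_quadratic_coefs K (t1 p.1) (t2 p.1) (t3 p.1) (t4 p.1) om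
  (Dy psi p) (k1 p.1) (k2 p.1) (k3 p.1) (l1 p.1) (l2 p.1) (l3 p.1) (l4 p.1)
  (a (phi p)) (b (phi p) * psi p) (lead p) beta _ gamma t10 k0).
move=> y1 y2.
have -> : beta * y2 ^+ 2 + (2 * gamma * p.2 + kappa - D ^+ 2) * y2 + 2 * gamma * y1 ^+ 2
  = rest p y1 y2 0 by rewrite /rest mulr0 add0r.
have B0 : Dy psi p / t1 p.1 ^+ 4 != 0 by rewrite mulf_neq0 ?invr_neq0 ?expf_neq0.
apply: (proj2 (affine_same_root B0 _)) => y4.
have [H [H1 [H2 [H3 [H4 [jH [h0 h1 h2 h3 h4]]]]]]] :=
  exists_total_jet4 p.1 p.2 y1 y2 0 y4.
have jv := jet4_quadratic c (w0 / (w1 * p.2 + w0)) om (total_jet4_jet4 p.1 jH).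
have ju := jet4D (jet4M jv jk) jl.
have vE : \forall x \near p.1, (om / 2 * H x ^+ 2 + w0 / (w1 * p.2 + w0) * H x + c)
    * Dy psi (x, p.2) + psi (x, p.2) = psi (x, H x).
  by apply: filterS (near_ball_graph r_gt0 jH h0) => x [xr Hr]; rewrite [RHS]psiE.
have {}ju := jet4_near_eq vE ju.
have := jets_equiv Up jH h0 (jphi _ _ _ _ _ jH h0) ju t10; cbv zeta.
rewrite h0 h1 h2 h3 h4 V0 om0 => ->.
rewrite !addrA -deriv4_wrt_affine0 //.
rewrite (_ : Dy psi (p.1, p.2) = Dy psi p); last by case: (p).
(* A congruence: [ring] then compares the arguments of [deriv4_wrt] one by one instead of expanding
   it. *)
suff E : forall x y x' y' z z' s s' c : K, x = x' -> y = y' -> z = z' -> s = s' ->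
  deriv4_wrt (t1 p.1) (t2 p.1) (t3 p.1) (t4 p.1) x y z s + a (phi p) * (x / t1 p.1) + c = 0
  <-> deriv4_wrt (t1 p.1) (t2 p.1) (t3 p.1) (t4 p.1) x' y' z' s' + a (phi p) * (x' / t1 p.1)
      + c = 0.
  by apply: E; move: (Dy psi p) => k; ring.
by move=> ? ? ? ? ? ? ? ? ? -> -> -> ->.
Qed.

Let Dyy_psi p : U p -> Dy (Dy psi) p * (alpha - 4 * nu) = 0.
Proof.
move=> Up; have [oU _ _ spsi _] := pt; have [_ _ E3 _] := second_order Up.
have dpsi F : smooth_on U F -> deriv_at p.2 (fun y => F (p.1, y)) (Dy F p).
  move=> sF; have := @deriv_at_vertical K F p.1 p.2; rewrite -surjective_pairing.
  by apply; exact: smooth_on_differentiable sF Up.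
have s1 := smooth_on_derive (0, 1) spsi; have s2 := smooth_on_derive (0, 1) s1.
pose f y := alpha * Dy psi (p.1, y) + - (4 * (nu * y + mu * D ^+ 2) * Dy (Dy psi) (p.1, y)).
have df : deriv_at p.2 f (Dy (Dy psi) p * (alpha - 4 * nu)).
  apply: deriv_at_eq.
    by rewrite /f; derive; [exact: dpsi s1|exact: dpsi s2].
  rewrite /= -surjective_pairing E3.
  by move: (Dy (Dy psi) p) (Dy psi p) => *; ring.
have f0 : \forall y \near p.2, cst 0 y = f y.
  have [r r0 rU] := box Up; apply: filterS (nbhsx_ballx p.2 r r0) => y yr.
  have [e _ _ _] := second_order (rU _ _ (ballxx _ r0) yr).
  by rewrite /f /= e subrr.
have [_ <-] := df; have [_ <-] := deriv_at_cst p.2 (0 : K).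
by apply: near_eq_derive; apply: filterS f0.
Qed.

Lemma linearizable_conditions : [/\ alpha = 4 * nu, beta = 3 * nu &
  kappa = (2 * gamma * mu + nu) * D ^+ 2 / nu].
Proof.
have [_ [p Up] _ _ _] := pt.
have [A0 _] := lead_neq0_Dy_phi Up; have [E1 E2 _ k0] := second_order Up.
have alphaE : alpha = 4 * nu.
  apply: contraTeq isT => alphan; move: gamma0.
  have psiyy0 q : U q -> Dy (Dy psi) q = 0.
    by move=> /Dyy_psi /eqP; rewrite mulf_eq0 subr_eq0 (negPf alphan) orbF => /eqP.
  (* With [psi] affine in y, the weights w1 = 0 and w0 = 1 fit, and [third_order] reads 0 = 2
     gamma. *)
  have /third_order /(_ p Up) : forall q, U q -> 0 * q.2 + 1 != 0 :> K /\
      Dy (Dy psi) q * (0 * q.2 + 1) = 0 * Dy psi q.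
    by move=> q Uq; rewrite psiyy0 // !mul0r add0r oner_eq0.
  by rewrite !mul0r => /esym/eqP; rewrite mulf_eq0 pnatr_eq0 /= => ->.
have betaE : beta = 3 * nu.
  apply: (mulIf k0); rewrite E2; apply: (@mulfI _ 4); first by rewrite pnatr_eq0.
  move: E1; rewrite alphaE; move: (Dy psi p) (Dy (Dy psi) p) (lead p) => k h A e.
  by transitivity (3 * (4 * A * h)); [ring|rewrite -e; ring].
split=> //.
(* With alpha = 4 nu, the first relation of [second_order] says that the leading coefficient itself
   is a valid weight. In the resulting identity [p.2] cancels. *)
have /third_order /(_ p Up) : forall q, U q -> nu * q.2 + mu * D ^+ 2 != 0 /\
    Dy (Dy psi) q * (nu * q.2 + mu * D ^+ 2) = nu * Dy psi q.
  move=> q Uq; have [q0 _] := lead_neq0_Dy_phi Uq; split=> //.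
  have [e _ _ _] := second_order Uq; apply: (@mulfI _ 4); first by rewrite pnatr_eq0.
  by rewrite [RHS]mulrA -alphaE e -[RHS]mulrA; congr (_ * _); exact: mulrC.
move=> e; apply: (mulfI nu0).
have -> : nu * kappa = (nu * p.2 + mu * D ^+ 2) *
    (nu / (nu * p.2 + mu * D ^+ 2) * (2 * gamma * p.2 + kappa - D ^+ 2))
    - nu * (2 * gamma * p.2 - D ^+ 2) by field.
by rewrite e; field.
Qed.

End Necessity.

(** * Locality of differentiability and a criterion for smoothness *)

Section Smoothness.
Context {K : numFieldType}.
Implicit Types (U : set (K * K)) (f g : K * K -> K) (p v : K * K).

(** The zero map is a differential, because the remainder vanishes identically near p. This makes
    [differentiable] depend only on the germ of the function. *)
Lemma near0_differentiable (V W : normedModType K) (f : V -> W) (p : V) : (\forall q \near p, f q = 0) -> differentiable f p.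
Proof.
move=> f0.
have e : f \o shift p = cst (f p) + (\0 : V -> W) +o_ 0 id.
  apply/eqaddoP => _/posnumP[e]; near=> y.
  have fy : f (y + p) = 0.
    near: y; have := f0; rewrite (near_shift 0) /=.
    by apply: filterS => y /=; rewrite subr0.
  rewrite !fctE /= fy (nbhs_singleton f0) addr0 subr0 normr0.
  by rewrite mulr_ge0 // ltW.
apply/diff_locallyP.
have -> : 'd f p = (\0 : V -> W) :> (V -> W).
  by apply: (@diff_unique _ _ _ _ \0) => // x; exact: cvg_cst.
by split => // x; exact: cvg_cst.
Unshelve. all: by end_near. Qed.

Lemma near_eq_differentiable (V W : normedModType K) (f g : V -> W) (p : V) : (\forall q \near p, f q = g q) ->
  differentiable g p -> differentiable f p.
Proof.
move=> fg dg; have -> : f = g + (f - g) by rewrite addrC subrK.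
apply: differentiableD => //; apply: near0_differentiable.
by apply: filterS fg => q fgq; rewrite !fctE fgq subrr.
Qed.

(** On an open set, equality of functions passes to their directional derivatives, whatever the
    values outside. *)
Lemma class_C_eq_on U f g n : open U -> (forall p, U p -> f p = g p) ->
  class_C n U g -> class_C n U f.
Proof.
move=> oU; have nU p : U p -> nbhs p U by move=> Up; exact: open_nbhs_nbhs.
elim: n f g => [|n IH] f g fg /=.
  move=> cg p Up; rewrite /prop_for /continuous_at (fg p Up).
  apply: cvg_trans (cg p Up); apply: near_eq_cvg.
  by apply: filterS (nU p Up) => q Uq; rewrite fg.
have fgn p : U p -> \forall q \near p, f q = g q.
  by move=> Up; apply: filterS (nU p Up) => q; exact: fg.
move=> [dg Dg]; split=> [p Up|v].
  by apply: near_eq_differentiable (dg p Up); exact: fgn.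
by apply: IH (Dg v) => p Up; apply: near_eq_derive; exact: fgn.
Qed.

(** Closure of [S] under directional derivatives replaces the computation of derivatives of all
    orders. *)
Lemma smooth_on_closed_class U (S : (K * K -> K) -> Prop) f : open U ->
  (forall g, S g -> (forall p, U p -> differentiable g p) /\
     forall v, exists2 h, S h & forall p, U p -> 'D_v g p = h p) ->
  S f -> smooth_on U f.
Proof.
move=> oU clS Sf n; elim: n f Sf => [|n IH] f Sf /=; have [df Df] := clS f Sf.
  by move=> p Up; exact: differentiable_continuous (df p Up).
split=> // v; have [h Sh hE] := Df v.
by apply: class_C_eq_on oU hE _; exact: IH.
Qed.

Lemma deriv_at_differentiable_fst (f : K -> K) a p : deriv_at p.1 f a ->
  differentiable (fun q => f q.1) p /\
  forall v, 'D_v (fun q => f q.1) p = v.1 * a.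
Proof.
move=> [/derivable1_diffP df <-].
have d1 : differentiable (@fst K K) p by apply: linear_differentiable => x; exact: cvg_fst.
have df1 : differentiable (f \o fst) p by exact: differentiable_comp.
split=> // v; rewrite (deriveE _ df1) diff_comp //= diff_lin; last first.
  by move=> x; exact: cvg_fst.
by rewrite (diff1E df) /= derive1E.
Qed.

Lemma differentiable_snd p : differentiable (@snd K K) p /\
  forall v, 'D_v (@snd K K) p = v.2.
Proof.
have cs : continuous (@snd K K) by move=> x; exact: cvg_snd.
have d2 : differentiable (@snd K K) p by exact: linear_differentiable.
by split=> // v; rewrite (deriveE _ d2) diff_lin.
Qed.

End Smoothness.

Lemma four_times_derivable_jet4 (K : numFieldType) (H : K -> K) z :
  four_times_derivable H z ->
  jet4 H (derive1n 1 H) (derive1n 2 H) (derive1n 3 H) (derive1n 4 H) z.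
Proof.
apply: filterS => x dH.
have D k : (k < 4)%N -> deriv_at x (derive1n k H) (derive1n k.+1 H x).
  by move=> k4; apply: DeriveDef; [exact: dH|rewrite derive1nS derive1E].
by split; [exact: (D 0%N)|exact: (D 1%N)|exact: (D 2)|exact: (D 3)].
Qed.

(* [c^-3] and [1 / c^2] are the multiplier and the derivative of the independent
   variable that take the third symmetric power [v'''' + 10 q v'' + 9 q^2 v] of
   [c'' + q c] to a plain fourth derivative. *)
Lemma deriv4_wrt_symmetric_power (K : numFieldType) (c d q m v v1 v2 v3 v4 : K) :
  c != 0 -> m != 0 ->
  let g := c^-1 ^+ 3 in let g1 := - 3 * d * c^-1 ^+ 4 in
  let g2 := 3 * q * c^-1 ^+ 3 + 12 * d ^+ 2 * c^-1 ^+ 5 in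
  let g3 := - 33 * q * d * c^-1 ^+ 4 - 60 * d ^+ 3 * c^-1 ^+ 6 in
  let g4 := 33 * q ^+ 2 * c^-1 ^+ 3 + 312 * q * d ^+ 2 * c^-1 ^+ 5
    + 360 * d ^+ 4 * c^-1 ^+ 7 in
  deriv4_wrt (m / c ^+ 2) (- 2 * m * d * c^-1 ^+ 3)
    (2 * m * q * c^-1 ^+ 2 + 6 * m * d ^+ 2 * c^-1 ^+ 4)
    (- 16 * m * q * d * c^-1 ^+ 3 - 24 * m * d ^+ 3 * c^-1 ^+ 5)
    (g1 * v + g * v1) (g2 * v + 2 * g1 * v1 + g * v2)
    (g3 * v + 3 * g2 * v1 + 3 * g1 * v2 + g * v3)
    (g4 * v + 4 * g3 * v1 + 6 * g2 * v2 + 4 * g1 * v3 + g * v4)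
  = c ^+ 5 / m ^+ 4 * (v4 + 10 * q * v2 + 9 * q ^+ 2 * v).
Proof. by move=> c0 m0 /=; rewrite /deriv4_wrt; field; rewrite m0. Qed.

(** * Sufficiency, for any c, d, T with c' = d, d' = - q c and T' = m / c^2 *)

Section Sufficiency.
Context {K : numFieldType}.
Variables (gamma mu nu kappa D : K) (c d T : K -> K) (q m z0 : K).
Hypotheses (nu0 : nu != 0) (kappaE : kappa = (2 * gamma * mu + nu) * D ^+ 2 / nu)
  (qE : q = gamma / (5 * nu)) (m0 : m != 0) (cz0 : c z0 != 0).
Hypotheses (dc : forall z, deriv_at z c (d z)) (dd : forall z, deriv_at z d (- (q * c z)))
  (dT : forall z, c z != 0 -> deriv_at z T (m / c z ^+ 2)).

Let U := [set p : K * K | c p.1 != 0 /\ nu * p.2 + mu * D ^+ 2 != 0].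
Let phi (p : K * K) := T p.1.
Let psi (p : K * K) := (c p.1)^-1 ^+ 3 * (p.2 ^+ 2 / 2 + D ^+ 2 * mu / nu * p.2).

(** An algebra of functions containing [phi] and [psi] and closed under derivatives on [U]: those of
    c, d, 1/c and T are polynomials in c, d and 1/c. *)
Inductive elementary : (K * K -> K) -> Prop :=
| elementary_cst a : elementary (fun=> a)
| elementary_snd : elementary snd
| elementary_c : elementary (fun p => c p.1)
| elementary_d : elementary (fun p => d p.1)
| elementary_cV : elementary (fun p => (c p.1)^-1)
| elementary_T : elementary (fun p => T p.1)
| elementaryD f g : elementary f -> elementary g -> elementary (f + g)
| elementaryM f g : elementary f -> elementary g -> elementary (f * g).

Let openU : open U.
Proof.
have nz (f : K * K -> K) : continuous f -> open [set p | f p != 0].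
  move=> cf; rewrite openE => p fp.
  by apply: (@cvgr_neq0 K K _ (nbhs p) _ f (f p)) => //; exact: cf.
apply: openI; apply: nz => p; apply: differentiable_continuous.
  by have [] := deriv_at_differentiable_fst (dc p.1).
have [ds _] := differentiable_snd p.
by apply: differentiableD => //; apply: differentiableM.
Qed.

Let elementary_differentiable f : elementary f ->
  (forall p, U p -> differentiable f p) /\
  forall v, exists2 h, elementary h & forall p, U p -> 'D_v f p = h p.
Proof.
elim=> {f} [a| | | | | |f g Sf [df Df] Sg [dg Dg]|f g Sf [df Df] Sg [dg Dg]].
- split=> // v; exists (fun=> 0); first exact: elementary_cst.
  by move=> p _; exact: derive_cst.
- split=> [p _|v]; first by have [] := differentiable_snd p.
  exists (fun=> v.2); first exact: elementary_cst.
  by move=> p _; have [_ ->] := differentiable_snd p.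
- split=> [p _|v]; first by have [] := deriv_at_differentiable_fst (dc p.1).
  exists ((fun=> v.1) * (fun p => d p.1)).
    by apply: elementaryM; [exact: elementary_cst|exact: elementary_d].
  by move=> p _; have [_ ->] := deriv_at_differentiable_fst (dc p.1).
- split=> [p _|v]; first by have [] := deriv_at_differentiable_fst (dd p.1).
  exists ((fun=> - (v.1 * q)) * (fun p => c p.1)).
    by apply: elementaryM; [exact: elementary_cst|exact: elementary_c].
  move=> p _; have [_ ->] := deriv_at_differentiable_fst (dd p.1).
  by rewrite mulrN mulrA -mulNr.
- have dcV p : U p -> deriv_at p.1 (fun z => (c z)^-1) (- c p.1 ^- 2 * d p.1).
    by move=> [c0 _]; exact: deriv_atV.
  split=> [p Up|v]; first by have [] := deriv_at_differentiable_fst (dcV p Up).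
  exists ((fun=> - v.1) * (fun p => (c p.1)^-1) * (fun p => (c p.1)^-1) * (fun p => d p.1)).
    apply: elementaryM; last exact: elementary_d.
    apply: elementaryM; last exact: elementary_cV.
    by apply: elementaryM; [exact: elementary_cst|exact: elementary_cV].
  move=> p Up; have [_ ->] := deriv_at_differentiable_fst (dcV p Up).
  by rewrite !fctE /= mulNr mulrN mulrA -exprVn expr2 !mulNr !mulrA.
- have dTp p : U p -> deriv_at p.1 T (m / c p.1 ^+ 2) by move=> [c0 _]; exact: dT.
  split=> [p Up|v]; first by have [] := deriv_at_differentiable_fst (dTp p Up).
  exists ((fun=> v.1 * m) * (fun p => (c p.1)^-1) * (fun p => (c p.1)^-1)).
    apply: elementaryM; last exact: elementary_cV.
    by apply: elementaryM; [exact: elementary_cst|exact: elementary_cV].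
  move=> p Up; have [_ ->] := deriv_at_differentiable_fst (dTp p Up).
  by rewrite !fctE /= -exprVn expr2 !mulrA.
- split=> [p Up|v]; first by apply: differentiableD; [exact: df|exact: dg].
  have [f' Sf' f'E] := Df v; have [g' Sg' g'E] := Dg v.
  exists (f' + g'); first exact: elementaryD.
  move=> p Up; rewrite deriveD; [|exact/diff_derivable/df|exact/diff_derivable/dg].
  by rewrite f'E // g'E.
- split=> [p Up|v]; first by apply: differentiableM; [exact: df|exact: dg].
  have [f' Sf' f'E] := Df v; have [g' Sg' g'E] := Dg v.
  exists (f * g' + g * f'); first by apply: elementaryD; exact: elementaryM.
  move=> p Up; rewrite deriveM; [|exact/diff_derivable/df|exact/diff_derivable/dg].
  by rewrite f'E // g'E.
Qed.

Lemma point_transformation_phi_psi : point_transformation U phi psi.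
Proof.
have sm f : elementary f -> smooth_on U f.
  by apply: smooth_on_closed_class openU elementary_differentiable.
have spsi : smooth_on U psi.
  apply/sm.
  have -> : psi = (fun p => (c p.1)^-1) * ((fun p => (c p.1)^-1) * (fun p => (c p.1)^-1))
      * (snd * snd * (fun=> 2^-1) + (fun=> D ^+ 2 * mu / nu) * snd).
    by apply/funext => p; rewrite /psi !fctE !exprS expr0 !mulr1.
  apply: elementaryM.
    by apply: elementaryM; [|apply: elementaryM]; exact: elementary_cV.
  apply: elementaryD; apply: elementaryM; try exact: elementary_snd; try exact: elementary_cst.
  by apply: elementaryM; exact: elementary_snd.
split; first exact: openU.
(* The second coordinate makes the leading coefficient equal to 1. *)
- exists (z0, (1 - mu * D ^+ 2) / nu); split=> //=.
  by rewrite mulrC divfK // subrK oner_eq0.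
- exact/sm/elementary_T.
- exact: spsi.
- move=> p [/= cp Ap].
  have [_ Dphi] := deriv_at_differentiable_fst (dT cp).
  have dpsi : differentiable psi p.
    exact: smooth_on_differentiable spsi (conj cp Ap : U p).
  have psiy : 'D_(0, 1) psi p = (c p.1)^-1 ^+ 3 * (p.2 + D ^+ 2 * mu / nu).
    have := @deriv_at_vertical _ psi p.1 p.2; rewrite -surjective_pairing => /(_ dpsi) [_ <-].
    have e : deriv_at p.2 (fun y => psi (p.1, y))
        ((c p.1)^-1 ^+ 3 * (p.2 + D ^+ 2 * mu / nu)).
      by rewrite /psi /=; apply: deriv_at_eq; [derive|rewrite /=; field; rewrite nu0].
    by have [_ ->] := e.
  rewrite !Dphi /= mul1r !mul0r subr0 psiy.
  have -> : p.2 + D ^+ 2 * mu / nu = (nu * p.2 + mu * D ^+ 2) / nu by field.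
  by rewrite !(mulf_neq0, invr_neq0, expf_neq0).
Qed.

Let near_c_neq0 z : c z != 0 -> \forall x \near z, c x != 0.
Proof. by move=> cz; apply: near_neq0 => //; exact: deriv_at_continuous (dc z). Qed.

Let jet4_T z : c z != 0 -> jet4 T (fun x => m / c x ^+ 2)
  (fun x => - 2 * m * d x * (c x)^-1 ^+ 3)
  (fun x => 2 * m * q * (c x)^-1 ^+ 2 + 6 * m * d x ^+ 2 * (c x)^-1 ^+ 4)
  (fun x => - 16 * m * q * d x * (c x)^-1 ^+ 3 - 24 * m * d x ^+ 3 * (c x)^-1 ^+ 5) z.
Proof.
move=> /near_c_neq0; apply: filterS => x cx.
have dcx := dc x; have ddx := dd x; have dcV := deriv_atV cx dcx.
split; first exact: dT.
- under eq_fun do rewrite -exprVn.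
  apply: deriv_at_eq; [derive|rewrite /=; move: (c x) cx (d x) => y y0 e; by field].
- by apply: deriv_at_eq; [derive|rewrite /=; move: (c x) cx (d x) => y y0 e; field].
- by apply: deriv_at_eq; [derive|rewrite /=; move: (c x) cx (d x) => y y0 e; field].
Qed.

Let jet4_cVX3 z : c z != 0 -> jet4 (fun x => (c x)^-1 ^+ 3)
  (fun x => - 3 * d x * (c x)^-1 ^+ 4)
  (fun x => 3 * q * (c x)^-1 ^+ 3 + 12 * d x ^+ 2 * (c x)^-1 ^+ 5)
  (fun x => - 33 * q * d x * (c x)^-1 ^+ 4 - 60 * d x ^+ 3 * (c x)^-1 ^+ 6)
  (fun x => 33 * q ^+ 2 * (c x)^-1 ^+ 3 + 312 * q * d x ^+ 2 * (c x)^-1 ^+ 5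
    + 360 * d x ^+ 4 * (c x)^-1 ^+ 7) z.
Proof.
move=> /near_c_neq0; apply: filterS => x cx.
have dcx := dc x; have ddx := dd x; have dcV := deriv_atV cx dcx.
by split; (apply: deriv_at_eq; [derive|rewrite /=; move: (c x) cx (d x) => y y0 e; field]).
Qed.

(** With u = c^-3 v, the value of b makes b u cancel the term 9 q^2 v of
    [deriv4_wrt_symmetric_power], which accounts for the power c^8. *)
Lemma mapped_to_linear_phi_psi (b : K -> K) :
  (forall z, c z != 0 -> b (T z) = - (9 * q ^+ 2 / m ^+ 4 * c z ^+ 8)) ->
  (forall z, c z != 0 -> {for T z, continuous b}) ->
  mapped_to_linear (profile_eq (4 * nu) (3 * nu) gamma mu nu kappa D) U phi psi (fun=> 0) b.
Proof.
move=> bE bc; split=> [p [cp _]|H z [cz Az] /four_times_derivable_jet4 jH]; cbv zeta.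
  by split; [exact: (deriv_at_continuous (deriv_at_cst _ _))|exact: bc].
move=> _; have {}cz : c z != 0 := cz; pose w := D ^+ 2 * mu / nu.
have ju := jet4M (jet4_cVX3 cz) (jet4_quadratic 0 w 1 jH).
have uE : (fun x => (c x)^-1 ^+ 3 * (1 / 2 * H x ^+ 2 + w * H x + 0)) =
    fun x => psi (x, H x).
  by apply/funext => x; rewrite /psi /= addr0 mul1r [2^-1 * _]mulrC.
rewrite uE in ju.
rewrite (iter4_deriv_wrt (jet4_T cz : jet4 (fun x => phi (x, H x)) _ _ _ _ z) ju); last first.
  by rewrite mulf_neq0 ?invr_neq0 ?expf_neq0.
rewrite deriv4_wrt_symmetric_power // mul0r addr0 bE //.
rewrite /profile_eq.
have -> : psi (z, H z) = (c z)^-1 ^+ 3 * (1 / 2 * H z ^+ 2 + w * H z + 0).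
  by rewrite -[LHS]/((fun x => psi (x, H x)) z) -uE.
rewrite -[c (z, H z).1]/(c z).
move: (derive1n 1 H z : K) (derive1n 2 H z : K) (derive1n 3 H z : K) (derive1n 4 H z : K).
move: (H z) (c z) cz => h0 c0 c0_neq0 h1 h2 h3 h4.
(* [X] is v'''' + 10 q v''; each of the two equations is a nonzero multiple of it. *)
pose X := (h0 + w) * h4 + 4 * h1 * h3 + 3 * h2 ^+ 2 + 10 * q * ((h0 + w) * h2 + h1 ^+ 2).
set L := (X in X = 0 <-> _); set M := (X in _ <-> X = 0).
have -> : L = nu * X by rewrite /L /X /w qE kappaE; field.
have -> : M = c0 ^+ 5 / m ^+ 4 * X by rewrite /M /X; field; rewrite m0.
split=> /eqP; rewrite mulf_eq0.
  by rewrite (negPf nu0) => /eqP ->; rewrite mulr0.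
rewrite mulf_eq0 invr_eq0 !expf_eq0 (negPf m0) (negPf c0_neq0) /= => /eqP ->.
by rewrite mulr0.
Qed.

End Sufficiency.

(** * Zero derivatives over the real and complex fields, and the complex exponential *)

(** This form allows complex derivatives to be restricted to real lines, and that of [expC] to be
    assembled from real estimates. *)
Lemma deriv_atP (K : numFieldType) (f : K -> K) (x a : K) : deriv_at x f a <->
  forall e : K, 0 < e -> exists2 r : K, 0 < r &
    forall h : K, `|h| < r -> `|f (x + h) - f x - h * a| <= e * `|h|.
Proof.
split=> [[df <-] e e0|H].
  have /eqaddoP/(_ e e0)/nbhs_ballP[r /= r0 rP] := derivable_nbhs df.
  exists r => // h hr.
  have := rP h; rewrite /ball /= sub0r normrN => /(_ hr).
  rewrite /= -![(_ + _ : _ -> _) _]/(_ + _) -![(- _ : _ -> _) _]/(- _) /cst /=.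
  by rewrite [_%:A]mulr1 [h + x]addrC opprD addrA.
have lim : (fun h => h^-1 *: ((f \o shift x) (h *: 1) - f x)) @ 0^' --> a.
  apply/cvgrPdist_le => e e0; have [r r0 rP] := H e e0.
  rewrite near_withinE; apply/nbhs_ballP; exists r => // h /=.
  rewrite /ball /= sub0r normrN => hr h0.
  have := rP h hr; rewrite [_%:A]mulr1 [h + x]addrC => fh.
  rewrite -(ler_pM2l (x := `|h|)) ?normr_gt0 // -normrM mulrBr.
  by rewrite [h * (_ *: _)]mulrA mulfV // mul1r distrC [leRHS]mulrC.
by apply: DeriveDef; [apply/cvg_ex; exists a|exact: cvg_lim lim].
Qed.

Section ConstancyReal.
Context {R : realType}.

Lemma zero_deriv_constant_real : zero_deriv_constant R.
Proof.
move=> f c r df y yr.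
have cr : ball c r c by apply: ballxx; apply: le_lt_trans yr; exact: normr_ge0.
have mid u v x : ball c r u -> ball c r v -> u <= x <= v -> ball c r x.
  by rewrite /ball /= !ltr_distlC => /andP[? ?] /andP[? ?] /andP[? ?]; lra.
have le_cst u v : ball c r u -> ball c r v -> u <= v -> f v = f u.
  move=> ur vr uv; apply/eqP; rewrite -subr_eq0; apply/eqP.
  have [||z _ ->] := @MVT_segment R f (fun=> 0) u v uv; last by rewrite mul0r.
    move=> x; rewrite in_itv /= => /andP[ux xv]; apply: df.
    by apply: (mid u v) => //; rewrite !ltW.
  apply: derivable_within_continuous => x; rewrite in_itv /= => uxv.
  by have [] := df x (mid _ _ _ ur vr uxv).
by have [/le_cst -> //|/ltW/le_cst ->] := leP c y.
Qed.

End ConstancyReal.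

Section ComplexDerivative.
Context {R : realType}.
Local Notation C := R[i].
Implicit Types (x y z w h : C).

(** In the order of [R[i]] positive elements are real, so radii and tolerances come from [R]. *)
Let gt0_real (e : C) : 0 < e -> exists2 r : R, 0 < r & e = r%:C%C.
Proof.
rewrite ltcE => /andP[/eqP/= e1 e2]; exists (complex.Re e) => //.
by case: e e1 e2 => a b /= -> _.
Qed.

Let normE z : exists2 n : R, 0 <= n & `|z| = n%:C%C.
Proof.
rewrite normc_def; eexists; last reflexivity.
exact: sqrtr_ge0.
Qed.

Let normRe z (n : R) : `|z| <= n%:C%C -> `|complex.Re z| <= n.
Proof. by move=> zn; rewrite -lecR; apply: le_trans (normc_ge_Re z) zn. Qed.

Let normRC (t : R) : `|t%:C%C : C| = `|t|%:C%C.
Proof. by rewrite normc_def /= expr0n /= addr0 sqrtr_sqr. Qed.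

(** The real part of f along the line through c and y is a real function with zero derivative. *)
Let Re_cst (f : C -> C) (c r : C) :
  (forall y, ball (c : (C : numFieldType)) r y -> deriv_at y f 0) ->
  forall y, ball (c : (C : numFieldType)) r y -> complex.Re (f y) = complex.Re (f c).
Proof.
move=> df y yr; have [->//|yc] := eqVneq y c.
have r_gt0 : 0 < r by apply: le_lt_trans yr; exact: normr_ge0.
have [rho rho0 rE] := gt0_real r_gt0.
have [n n_ge0 nE] := normE (y - c).
have n0 : 0 < n by rewrite -ltcR -nE normr_gt0 subr_eq0.
pose p (s : R) := c + s%:C%C * (y - c).
pose g s := complex.Re (f (p s)).
have -> : complex.Re (f y) = g 1 by rewrite /g /p mul1r addrC subrK.
have -> : complex.Re (f c) = g 0 by rewrite /g /p mul0r addr0.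
(* The parameter s lies within rho / n of 0 exactly when [p s] lies in the given ball; 1 qualifies
   because y does. *)
apply: (@zero_deriv_constant_real R g 0 (rho / n)); last first.
  rewrite /ball /= sub0r normrN normr1 ltr_pdivlMr // mul1r -ltcR -nE -rE distrC.
  exact: yr.
move=> s; rewrite /ball /= sub0r normrN ltr_pdivlMr // => sr.
have /deriv_atP H : deriv_at (p s) f 0.
  apply: df; rewrite /ball /= /p opprD addNKr normrN normrM normRC nE rE.
  by rewrite -rmorphM ltcR.
apply/deriv_atP => e e0.
have en0 : 0 < (e / n)%:C%C :> C by rewrite ltcR divr_gt0.
have [r' /gt0_real[rho' rho'0 ->] r'P] := H _ en0.
exists (rho' / n); first by rewrite divr_gt0.
move=> t; rewrite ltr_pdivlMr // => tr; rewrite mulr0 subr0.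
have := r'P (t%:C%C * (y - c)); rewrite normrM normRC nE -!rmorphM ltcR => /(_ tr).
rewrite mulr0 subr0 => fE.
have -> : g (s + t) - g s = complex.Re (f (p s + t%:C%C * (y - c)) - f (p s)).
  rewrite /g /p rmorphD mulrDl addrA /=.
  by move: (f _) (f _) => [a1 a2] [b1 b2].
by apply: normRe; apply: le_trans fE _; rewrite lecR mulrCA divfK ?gt_eqF // mulrC.
Qed.

Lemma zero_deriv_constant_complex : zero_deriv_constant C.
Proof.
move=> f c r df y yr.
have e1 := Re_cst df yr.
(* The real part of i f is minus the imaginary part of f. *)
have dfi y' : ball (c : (C : numFieldType)) r y' ->
    deriv_at y' (fun y => f y * Complex 0 1) 0.
  move=> /df dfy; apply: deriv_at_eq; first by derive.
  by rewrite mulr0 mulr0 addr0.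
have := Re_cst dfi yr; rewrite !ReiNIm => /oppr_inj e2.
by move: e1 e2; case: (f y) => ? ?; case: (f c) => ? ? /= -> ->.
Qed.

Let norm_le (a b n : R) : `|a| + `|b| <= n -> `|Complex a b : C| <= n%:C%C.
Proof.
move=> abn; have -> : Complex a b = a%:C%C + Complex 0 1 * b%:C%C :> C.
  by apply/eqP; rewrite eq_complex /=; apply/andP; split; apply/eqP; ring.
apply: le_trans (ler_normD _ _) _.
rewrite normrM normRC normRC (_ : `|Complex 0 1| = 1 :> C); last first.
  by rewrite normc_def /= expr0n expr1n add0r sqrtr1.
by rewrite mul1r -rmorphD lecR.
Qed.

Lemma expCD x y : expC (x + y) = expC x * expC y.
Proof.
case: x y => [a b] [a' b']; rewrite /expC /= expRD cosD sinD.
by apply/eqP; rewrite eq_complex /=; apply/andP; split; apply/eqP; ring.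
Qed.

Lemma expC0 : expC 0 = 1 :> C.
Proof. by rewrite /expC /= expR0 cos0 sin0 mul1r mulr0. Qed.

Let expC_near0 (e : R) : 0 < e -> exists2 r : R, 0 < r & forall a b n : R,
  `|a| <= n -> `|b| <= n -> n < r ->
  `|expR a * cos b - 1 - a| + `|expR a * sin b - b| <= e * n.
Proof.
(* The four remainders below are bounded by t n, 3 t n, 3 t n and 2 t n, which sum to 9 t n. *)
move=> e0; pose t := Num.min 1 (e / 9).
have t0 : 0 < t by rewrite lt_min ltr01 divr_gt0.
have t1 : t <= 1 by rewrite ge_min lexx.
have te : 9 * t <= e by rewrite mulrC -ler_pdivlMr // ge_min lexx orbT.
clearbody t.
have dexp : deriv_at (0 : R) expR 1 by rewrite -expR0; exact: is_derive_expR.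
have dcos : deriv_at (0 : R) cos 0.
  by have := is_derive_cos (0 : R); rewrite sin0 oppr0.
have dsin : deriv_at (0 : R) sin 1 by rewrite -cos0; exact: is_derive_sin.
have [r1 r10 P1] := (deriv_atP _ _ _).1 dexp t t0.
have [r2 r20 P2] := (deriv_atP _ _ _).1 dcos t t0.
have [r3 r30 P3] := (deriv_atP _ _ _).1 dsin t t0.
exists (Num.min (Num.min t r1) (Num.min r2 r3)); first by rewrite !lt_min t0 r10 r20 r30.
move=> a b n an bn; rewrite !lt_min => /andP[/andP[nt n1] /andP[n2 n3]].
have /P1 := le_lt_trans an n1; have /P2 := le_lt_trans bn n2.
have /P3 := le_lt_trans bn n3.
rewrite !add0r expR0 cos0 sin0 mulr0 !mulr1 !subr0 => Psin Pcos Pexp.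
have tn0 : 0 <= t * n by apply: mulr_ge0; [exact: ltW|exact: le_trans (normr_ge0 a) an].
have {}Psin : `|sin b - b| <= t * n by apply: le_trans Psin _; rewrite ler_pM2l.
have {}Pcos : `|cos b - 1| <= t * n by apply: le_trans Pcos _; rewrite ler_pM2l.
have {}Pexp : `|expR a - 1 - a| <= t * n by apply: le_trans Pexp _; rewrite ler_pM2l.
have exp1 : `|expR a - 1| <= 2 * t.
  have -> : expR a - 1 = (expR a - 1 - a) + a by rewrite subrK.
  apply: le_trans (ler_normD _ _) _.
  have : t * n <= t by rewrite ler_piMr ?ltW // (lt_le_trans nt).
  by lra.
have exp3 : `|expR a| <= 3.
  have -> : expR a = (expR a - 1) + 1 by rewrite subrK.
  by apply: le_trans (ler_normD _ _) _; rewrite normr1; lra.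
have -> : expR a * cos b - 1 - a = (expR a - 1 - a) + expR a * (cos b - 1) by ring.
have -> : expR a * sin b - b = expR a * (sin b - b) + (expR a - 1) * b by ring.
have h1 : `|expR a * (cos b - 1)| <= 3 * (t * n) by rewrite normrM ler_pM.
have h2 : `|expR a * (sin b - b)| <= 3 * (t * n) by rewrite normrM ler_pM.
have h3 : `|(expR a - 1) * b| <= 2 * t * n by rewrite normrM ler_pM.
have : 9 * t * n <= e * n by rewrite ler_wpM2r // (le_trans (normr_ge0 a)).
have := ler_normD (expR a - 1 - a) (expR a * (cos b - 1)).
have := ler_normD (expR a * (sin b - b)) ((expR a - 1) * b).
by lra.
Qed.

Lemma deriv_at_expC z : deriv_at z expC (expC z).
Proof.
apply/deriv_atP => e e0.
have [M M0 ME] := normE (expC z).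
have [e' e'0 eE] := gt0_real e0.
(* By [expCD] the remainder at z is [expC z] times the one at 0; M + 1 is a visibly positive bound
   for its norm M. *)
have [|r r0 rP] := @expC_near0 (e' / (M + 1)); first by rewrite divr_gt0 // ltr_wpDl.
exists r%:C%C; first by rewrite ltcR.
move=> h hr; have [n n0 nE] := normE h.
have -> : expC (z + h) - expC z - h * expC z = expC z * (expC h - 1 - h).
  by rewrite expCD; ring.
have hn : `|h| <= n%:C%C by rewrite nE.
have Re_n := normRe hn.
have Im_n : `|complex.Im h| <= n.
  have := @normRe (h * Complex 0 1) n; rewrite ReiNIm normrN; apply.
  by rewrite normrM (_ : `|Complex 0 1| = 1 :> C) ?mulr1 // normc_def /= expr0n expr1n add0r sqrtr1.
have nr : n < r by rewrite -ltcR -nE.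
have le1 : `|expC h - 1 - h| <= (e' / (M + 1) * n)%:C%C.
  have -> : expC h - 1 - h = Complex (expR (complex.Re h) * cos (complex.Im h) - 1 - complex.Re h)
      (expR (complex.Re h) * sin (complex.Im h) - complex.Im h).
    by case: (h) => a b; rewrite /expC /=; apply/eqP; rewrite eq_complex /= subr0 !eqxx.
  by apply: norm_le; exact: rP.
rewrite normrM ME eE nE -[leRHS]rmorphM.
have MC0 : 0 <= M%:C%C :> C by rewrite lecR.
apply: (le_trans (ler_wpM2l MC0 le1)).
rewrite -rmorphM lecR mulrA; apply: ler_wpM2r => //.
have M1 : M / (M + 1) <= 1 by rewrite ler_pdivrMr ?mul1r ?lerDl // ltr_wpDl.
by rewrite mulrCA ler_piMr // ltW.
Qed.

End ComplexDerivative.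

(** * The tangent and exponential transformations *)

Section Tangent.
Context {K : numFieldType}.

(** Stated for abstract C and S so as to cover the real and complex cosine and sine. Here q = om^2
    and m = om, so 9 q^2 / m^4 is 9. *)
Lemma tangent_linearization (alpha beta gamma mu nu kappa D om : K) (C S : K -> K) :
  nu != 0 -> gamma != 0 ->
  [/\ alpha = 4 * nu, beta = 3 * nu & kappa = (2 * gamma * mu + nu) * D ^+ 2 / nu] ->
  om ^+ 2 = gamma / (5 * nu) ->
  (forall z, deriv_at z C (- S z)) -> (forall z, deriv_at z S (C z)) ->
  (forall z, C z ^+ 2 + S z ^+ 2 = 1) -> C 0 != 0 ->
  let E := profile_eq alpha beta gamma mu nu kappa D in
  let U := [set p : K * K | C (om * p.1) != 0 /\ nu * p.2 + mu * D ^+ 2 != 0] in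
  let phi := fun p : K * K => S (om * p.1) / C (om * p.1) in
  let psi := fun p : K * K =>
    (C (om * p.1))^-1 ^+ 3 * (p.2 ^+ 2 / 2 + D ^+ 2 * mu / nu * p.2) in
  point_transformation U phi psi /\
  exists b : K -> K,
    (forall z, C (om * z) != 0 ->
       b (S (om * z) / C (om * z)) = - (9 * C (om * z) ^+ 8)) /\
    mapped_to_linear E U phi psi (fun=> 0) b.
Proof.
move=> nu0 gamma0 [-> -> kappaE] om2 dC dS CS C0 E U phi psi.
have om0 : om != 0.
  by rewrite -sqrf_eq0 om2 mulf_neq0 // invr_neq0 // mulf_neq0 // pnatr_eq0.
pose c z := C (om * z).
have lin z : deriv_at z (fun z => om * z) om.
  by apply: deriv_at_eq; [derive|rewrite mulr1 mulr0 addr0].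
have dc z : deriv_at z c (- om * S (om * z)).
  by apply: deriv_at_eq; [exact: (deriv_at_comp (dC _) (lin z))|rewrite mulrC mulrN mulNr].
have dcs z : deriv_at z (fun z => S (om * z)) (om * c z).
  by apply: deriv_at_eq; [exact: (deriv_at_comp (dS _) (lin z))|rewrite mulrC].
have dd z : deriv_at z (fun z => - om * S (om * z)) (- (om ^+ 2 * c z)).
  apply: deriv_at_eq; first by derive; exact: dcs.
  by rewrite /=; ring.
have dT z : c z != 0 -> deriv_at z (fun z => S (om * z) / c z) (om / c z ^+ 2).
  move=> cz; apply: deriv_at_eq.
    by apply: deriv_atM; [exact: dcs|exact: (deriv_atV cz (dc z))].
  have := CS (om * z); rewrite -/(c z); move: (c z) (S (om * z)) cz => y s y0 e.
  rewrite -[X in _ = X / _]mulr1 -e; field.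
  exact: y0.
have c00 : c 0 != 0 by rewrite /c mulr0.
have pt := point_transformation_phi_psi mu D nu0 om0 c00 dc dd dT.
split; first exact: pt.
have T2 z : c z != 0 -> 1 + (S (om * z) / c z) ^+ 2 = (c z ^+ 2)^-1.
  move=> cz; have := CS (om * z); rewrite -/(c z) => e.
  apply: (mulfI (x := c z ^+ 2)); first by rewrite expf_neq0.
  by rewrite mulrDr mulr1 expr_div_n mulrCA !mulfV ?expf_neq0 // mulr1.
(* By [T2], 1 + t^2 is c^-2 at t = S/C, so this is - 9 c^8 as a function of t. *)
exists (fun t => - (9 * (1 + t ^+ 2)^-1 ^+ 4)).
have bE z : c z != 0 -> - (9 * (1 + (S (om * z) / c z) ^+ 2)^-1 ^+ 4) = - (9 * c z ^+ 8).
  by move=> cz; rewrite T2 // invrK -exprM.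
split; first exact: bE.
apply: (mapped_to_linear_phi_psi nu0 kappaE om2 om0 dc dd dT) => z cz.
  rewrite bE // -exprM; congr (- (_ * _)).
  by rewrite mulfK // expf_neq0.
have nz : 1 + (S (om * z) / c z) ^+ 2 != 0 by rewrite T2 // invr_neq0 // expf_neq0.
by apply: deriv_at_continuous; derive; apply: (deriv_atV (f := fun t => 1 + t ^+ 2)) => //; derive.
Qed.

(** For c = e(om z) with om^2 = - q, again c'' = - q c, and T = c^-2 has derivative - 2 om / c^2, so
    m = - 2 om. *)
Lemma exponential_linearization (alpha beta gamma mu nu kappa D om : K) (e : K -> K) :
  nu != 0 -> gamma != 0 ->
  [/\ alpha = 4 * nu, beta = 3 * nu & kappa = (2 * gamma * mu + nu) * D ^+ 2 / nu] ->
  om ^+ 2 = - (gamma / (5 * nu)) ->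
  (forall z, deriv_at z e (e z)) -> (forall z, e z != 0) ->
  linearizable (profile_eq alpha beta gamma mu nu kappa D).
Proof.
move=> nu0 gamma0 [-> -> kappaE] om2 de e0.
have om0 : om != 0.
  by rewrite -sqrf_eq0 om2 oppr_eq0 mulf_neq0 // invr_neq0 // mulf_neq0 // pnatr_eq0.
pose c z := e (om * z).
have c0 z : c z != 0 by exact: e0.
have dc z : deriv_at z c (om * c z).
  have lin : deriv_at z (fun z => om * z) om.
    by apply: deriv_at_eq; [derive|rewrite mulr1 mulr0 addr0].
  by apply: deriv_at_eq; [exact: (deriv_at_comp (de _) lin)|rewrite mulrC].
have dd z : deriv_at z (fun z => om * c z) (- (- om ^+ 2 * c z)).
  apply: deriv_at_eq; first by derive; exact: dc.
  by rewrite /=; ring.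
have dT z : c z != 0 -> deriv_at z (fun z => (c z)^-1 ^+ 2) (- 2 * om / c z ^+ 2).
  move=> cz; apply: deriv_at_eq; first by derive; exact: (deriv_atV cz (dc z)).
  by rewrite /=; move: (c z) cz => y y0; field.
have m0 : - 2 * om != 0 by rewrite mulNr oppr_eq0 mulf_neq0 // pnatr_eq0.
have qE : - om ^+ 2 = gamma / (5 * nu) by rewrite om2 opprK.
have pt := point_transformation_phi_psi mu D nu0 m0 (c0 0) dc dd dT.
(* Since T = c^-2, the power T^-4 is c^8. *)
eexists _, _, _, (fun=> 0), (fun t => - (9 * (- om ^+ 2) ^+ 2 / (- 2 * om) ^+ 4 * t^-1 ^+ 4)).
split; first exact: pt.
apply: (mapped_to_linear_phi_psi nu0 kappaE qE m0 dc dd dT) => z cz.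
  have -> : ((c z)^-1 ^+ 2)^-1 = c z ^+ 2 by rewrite -exprVn invrK.
  by rewrite -exprM.
by apply: deriv_at_continuous; derive; (apply: (deriv_atV (f := id));
  [by rewrite expf_neq0 // invr_neq0|by derive]).
Qed.

End Tangent.

(** * Complex sine and cosine *)

Section ComplexTrigonometricDerivatives.
Context {R : realType}.
Implicit Types z : R[i].

Let i2 : Complex 0 1 * Complex 0 1 = -1 :> R[i].
Proof. by rewrite -expr2 sqr_i. Qed.

Let i0 : Complex 0 1 != 0 :> R[i].
Proof. by rewrite eq_complex /= oner_eq0 andbF. Qed.

Let deriv_at_expC_lin (a : R[i]) z : deriv_at z (fun z => expC (a * z)) (a * expC (a * z)).
Proof.
apply: deriv_at_eq; first apply: (deriv_at_comp (deriv_at_expC _)); first by derive.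
by rewrite /= mulr0 addr0 mulr1 mulrC.
Qed.

Let cosCE z : cosC z = (expC (Complex 0 1 * z) + expC (- Complex 0 1 * z)) / 2.
Proof. by rewrite /cosC mulNr. Qed.

Let sinCE z : sinC z = (expC (Complex 0 1 * z) - expC (- Complex 0 1 * z)) / (2 * Complex 0 1).
Proof. by rewrite /sinC mulNr. Qed.

Lemma deriv_at_cosC z : deriv_at z cosC (- sinC z).
Proof.
rewrite (funext cosCE) sinCE; apply: deriv_at_eq; first by derive; exact: deriv_at_expC_lin.
move: (expC (Complex 0 1 * z)) (expC (- Complex 0 1 * z)) => u v /=.
move: i2 i0; move: (Complex 0 1) => i ii i_neq0.
by transitivity (i * i * ((u - v) / (2 * i))); [field|rewrite ii mulN1r].
Qed.

Lemma deriv_at_sinC z : deriv_at z sinC (cosC z).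
Proof.
rewrite (funext sinCE) cosCE; apply: deriv_at_eq; first by derive; exact: deriv_at_expC_lin.
move: (expC (Complex 0 1 * z)) (expC (- Complex 0 1 * z)) => u v /=; move: i0; move: (Complex 0 1) => i i_neq0.
by field.
Qed.

(** With u and v the exponentials of i z and - i z, the sum is ((u + v)^2 - (u - v)^2) / 4 = u v =
    1. *)
Lemma cosC2_sinC2 z : cosC z ^+ 2 + sinC z ^+ 2 = 1.
Proof.
have : expC (Complex 0 1 * z) * expC (- Complex 0 1 * z) = 1.
  by rewrite -expCD mulNr subrr expC0.
rewrite cosCE sinCE; move: (expC (Complex 0 1 * z)) (expC (- Complex 0 1 * z)) => u v uv.
transitivity (u * v) => //; move: i2 i0; move: (Complex 0 1) => i ii i_neq0.
have -> : ((u - v) / (2 * i)) ^+ 2 = (u - v) ^+ 2 / (4 * (i * i)) by field.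
by rewrite ii; field.
Qed.

Lemma cosC0 : cosC 0 = 1 :> R[i].
Proof. by rewrite /cosC !(mulr0, oppr0) expC0 -[1 + 1]/(2%:R) divff // pnatr_eq0. Qed.

End ComplexTrigonometricDerivatives.

Theorem mainTheorem5 (R : realType) :
  (* real constants, real-valued H of a real variable *)
  (forall alpha beta gamma mu nu kappa D : R,
     nu != 0 -> gamma != 0 ->
     let E := profile_eq alpha beta gamma mu nu kappa D in
     let conditions := [/\ alpha = 4 * nu, beta = 3 * nu &
                           kappa = (2 * gamma * mu + nu) * D ^+ 2 / nu] in
     (linearizable E <-> conditions) /\
     (conditions -> 0 < gamma / (5 * nu) ->
      let omega := Num.sqrt (gamma / (5 * nu)) in
      let U := [set p : R * R |
                  cos (omega * p.1) != 0 /\ nu * p.2 + mu * D ^+ 2 != 0] in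
      let phi := fun p : R * R => tan (omega * p.1) in
      let psi := fun p : R * R =>
        (cos (omega * p.1))^-1 ^+ 3 * (p.2 ^+ 2 / 2 + D ^+ 2 * mu / nu * p.2) in
      point_transformation U phi psi /\
      exists b : R -> R,
        (forall z, cos (omega * z) != 0 ->
           b (tan (omega * z)) = - (9 * cos (omega * z) ^+ 8)) /\
        mapped_to_linear E U phi psi (fun=> 0) b))
  /\
  (* complex constants, holomorphic H of a complex variable *)
  (forall alpha beta gamma mu nu kappa D : R[i],
     nu != 0 -> gamma != 0 ->
     let E := profile_eq alpha beta gamma mu nu kappa D in
     let conditions := [/\ alpha = 4 * nu, beta = 3 * nu &
                           kappa = (2 * gamma * mu + nu) * D ^+ 2 / nu] in
     (linearizable E <-> conditions) /\
     (conditions ->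
      let omega := sqrtC (gamma / (5 * nu)) in
      let U := [set p : R[i] * R[i] |
                  cosC (omega * p.1) != 0 /\ nu * p.2 + mu * D ^+ 2 != 0] in
      let phi := fun p : R[i] * R[i] => tanC (omega * p.1) in
      let psi := fun p : R[i] * R[i] =>
        (cosC (omega * p.1))^-1 ^+ 3 * (p.2 ^+ 2 / 2 + D ^+ 2 * mu / nu * p.2) in
      point_transformation U phi psi /\
      exists b : R[i] -> R[i],
        (forall z, cosC (omega * z) != 0 ->
           b (tanC (omega * z)) = - (9 * cosC (omega * z) ^+ 8)) /\
        mapped_to_linear E U phi psi (fun=> 0) b)).
Proof.
split=> alpha beta gamma mu nu kappa D nu0 gamma0 E conditions.
- have tangent : conditions -> 0 < gamma / (5 * nu) ->
      let omega := Num.sqrt (gamma / (5 * nu)) in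
      let U := [set p : R * R |
                  cos (omega * p.1) != 0 /\ nu * p.2 + mu * D ^+ 2 != 0] in
      let phi := fun p : R * R => tan (omega * p.1) in
      let psi := fun p : R * R =>
        (cos (omega * p.1))^-1 ^+ 3 * (p.2 ^+ 2 / 2 + D ^+ 2 * mu / nu * p.2) in
      point_transformation U phi psi /\
      exists b : R -> R,
        (forall z, cos (omega * z) != 0 ->
           b (tan (omega * z)) = - (9 * cos (omega * z) ^+ 8)) /\
        mapped_to_linear E U phi psi (fun=> 0) b.
    move=> cond q0 omega.
    have om2 : omega ^+ 2 = gamma / (5 * nu) by rewrite sqr_sqrtr // ltW.
    apply: (@tangent_linearization R alpha beta gamma mu nu kappa D omega cos sin) => //.
    - by move=> z; exact: is_derive_cos.
    - by move=> z; exact: is_derive_sin.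
    - by move=> z; exact: cos2Dsin2.
    - by rewrite cos0 oner_eq0.
  split=> //; split=> [[U [phi [psi [a [b [pt mp]]]]]]|cond].
    exact: (linearizable_conditions nu0 gamma0 pt mp zero_deriv_constant_real).
  have q0 : gamma / (5 * nu) != 0.
    by rewrite mulf_neq0 // invr_neq0 // mulf_neq0 // pnatr_eq0.
  (* For a negative quotient [Num.sqrt] returns 0 and the tangent degenerates, so the exponential
     transformation takes over. *)
  move: q0; rewrite neq_lt => /orP[q_lt0|q_gt0].
    apply: (@exponential_linearization R alpha beta gamma mu nu kappa D
      (Num.sqrt (- (gamma / (5 * nu)))) expR) => //.
    - by rewrite sqr_sqrtr // oppr_ge0 ltW.
    - by move=> z; exact: is_derive_expR.
    - by move=> z; rewrite gt_eqF // expR_gt0.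
  have [pt [b [_ mp]]] := tangent cond q_gt0.
  by eexists _, _, _, (fun=> 0), b; exact: conj pt mp.
- have tangent : conditions ->
      let omega := sqrtC (gamma / (5 * nu)) in
      let U := [set p : R[i] * R[i] |
                  cosC (omega * p.1) != 0 /\ nu * p.2 + mu * D ^+ 2 != 0] in
      let phi := fun p : R[i] * R[i] => tanC (omega * p.1) in
      let psi := fun p : R[i] * R[i] =>
        (cosC (omega * p.1))^-1 ^+ 3 * (p.2 ^+ 2 / 2 + D ^+ 2 * mu / nu * p.2) in
      point_transformation U phi psi /\
      exists b : R[i] -> R[i],
        (forall z, cosC (omega * z) != 0 ->
           b (tanC (omega * z)) = - (9 * cosC (omega * z) ^+ 8)) /\
        mapped_to_linear E U phi psi (fun=> 0) b.
    move=> cond omega.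
    have om2 : omega ^+ 2 = gamma / (5 * nu) by exact: sqrtCK.
    apply: (@tangent_linearization _ alpha beta gamma mu nu kappa D omega cosC sinC) => //.
    - exact: deriv_at_cosC.
    - exact: deriv_at_sinC.
    - exact: cosC2_sinC2.
    - by rewrite cosC0 oner_eq0.
  split=> //; split=> [[U [phi [psi [a [b [pt mp]]]]]]|cond].
    exact: (linearizable_conditions nu0 gamma0 pt mp (@zero_deriv_constant_complex R)).
  have [pt [b [_ mp]]] := tangent cond.
  by eexists _, _, _, (fun=> 0), b; exact: conj pt mp.
Qed.
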